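(* Let $k$ be a field of characteristic $0$, $G$ a quasi-finite group with a fixed quasi-finite sequence $G_1,G_2,G_3,\dots$, $H$ a subgroup of $G$, and $M$ a $kH$-module. Then $\mathrm{Ind}_H^GM=kG\otimes_{kH}M$ is an irreducible $kG$-module if the following two conditions are satisfied: (1) $M$ is an irreducible $kH$-module which is quasi-finite with respect to the sequence $H\cap G_1,H\cap G_2,H\cap G_3,\dots$; let $M_1,M_2,M_3,\dots$ be a quasi-finite sequence of $M$. (2) For any positive integer $i$ and any $s\in G_i\setminus(H\cap G_i)$, the two representations $M_{i,s}$ and $M_i$ of the group $H_{s,i}=sHs^{-1}\cap H\cap G_i$ have no common composition factors, where $M_i$ is regarded as an $H_{s,i}$-module by restriction and $M_{i,s}$ is the $H_{s,i}$-module with underlying space $M_i$ on which $g\in H_{s,i}$ acts as $s^{-1}gs$ acts on $M_i$.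
   Context: A group $G$ is quasi-finite if it has a sequence $G_1,G_2,\dots$ of finite subgroups such that $G$ is the union of all $G_i$ and for any $i,j$ there is $r$ with $G_i,G_j\subset G_r$; such a sequence is a quasi-finite sequence of $G$. For a subgroup $H$ of $G$ the induced quasi-finite sequence is $H\cap G_1,H\cap G_2,\dots$. An irreducible module $N$ of a quasi-finite group $G$ is quasi-finite (with respect to $G_1,G_2,\dots$) if it has a sequence of subspaces $N_1,N_2,\dots$ such that (1) each $N_i$ is an irreducible $G_i$-submodule of $N$; (2) if $G_i$ is a subgroup of $G_j$ then $N_i\subset N_j$; (3) $N$ is the union of all $N_i$. Such a sequence is called a quasi-finite sequence of $N$. *)

(* Defs.v *)
From HB Require Import structures.
From mathcomp Require Import all_boot all_algebra finmap.
From mathcomp Require Import boolp classical_sets cardinality.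
From mathcomp.multinomials Require Import monalg.

Set Implicit Arguments.
Unset Strict Implicit.
Unset Printing Implicit Defensive.

Import GRing.Theory.
Local Open Scope ring_scope.
Local Open Scope quotient_scope.

(* Subgroups and submodules are given by boolean predicates.  The axioms of   *)
(* boolp turn every Prop-valued predicate into a boolean one, so this is no   *)
(* restriction.                                                               *)

Section Push.
Context (X Y : choiceType) (A : zmodType).
Implicit Types (a b : {malg A[X]}).

Definition mpush (f : X -> Y) a : {malg A[Y]} :=
  \sum_(x <- msupp a) << a@_x *g f x >>.

Lemma mpushEw (f : X -> Y) (d : {fset X}) a : (msupp a `<=` d)%fset ->
  mpush f a = \sum_(x <- d) << a@_x *g f x >>.
Proof.
move=> le; rewrite /mpush (big_fset_incl _ le) //= => x _ /mcoeff_outdom ->.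
by rewrite monalgU0.
Qed.

Lemma mpushU (f : X -> Y) c x : mpush f << c *g x >> = << c *g f x >>.
Proof. by rewrite (mpushEw _ msuppU_le) big_seq_fset1 mcoeffUU. Qed.

Lemma mpush_is_zmod_morphism (f : X -> Y) : zmod_morphism (mpush f).
Proof.
move=> a b; pose d := (msupp a `|` msupp b)%fset.
rewrite (mpushEw f (msuppB_le a b)) (mpushEw f (fsubsetUl _ (msupp b))).
rewrite (mpushEw f (fsubsetUr (msupp a) _)) -sumrB.
by apply: eq_bigr => x _; rewrite mcoeffB monalgUB.
Qed.

HB.instance Definition _ (f : X -> Y) :=
  GRing.isZmodMorphism.Build {malg A[X]} {malg A[Y]} (mpush f)
    (mpush_is_zmod_morphism f).

End Push.

(* The group algebra kG, as finitely supported functions under convolution;   *)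
(* a kG-module is then an lmodType over the ring galg k G.                    *)

Definition galg (k : fieldType) (G : groupType) := {malg k[G]}.

HB.instance Definition _ k G := GRing.Lmodule.on (galg k G).

Section GroupAlgebra.
Context (k : fieldType) (G : groupType).
Implicit Types (a b c : galg k G) (x y : G).

Definition gelt x : galg k G := << x >>.

Definition galg_mul a b : galg k G :=
  \sum_(x <- msupp a) \sum_(y <- msupp b) << a@_x * b@_y *g (x * y)%g >>.

Lemma galg_mulEw (d1 d2 : {fset G}) a b :
    (msupp a `<=` d1)%fset -> (msupp b `<=` d2)%fset ->
  galg_mul a b =
    \sum_(x <- d1) \sum_(y <- d2) << a@_x * b@_y *g (x * y)%g >>.
Proof.
move=> le1 le2; rewrite /galg_mul (big_fset_incl _ le1) /=.
  apply: eq_bigr => x _; apply: big_fset_incl => // y _ /mcoeff_outdom ->.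
  by rewrite mulr0 monalgU0.
by move=> x _ /mcoeff_outdom ax; rewrite big1 // => y _; rewrite ax mul0r monalgU0.
Qed.

Lemma galg_mulDl : left_distributive galg_mul +%R.
Proof.
move=> a b c; rewrite (galg_mulEw (msuppD_le a b) (fsubset_refl _)).
rewrite (galg_mulEw (fsubsetUl _ (msupp b)) (fsubset_refl _)).
rewrite (galg_mulEw (fsubsetUr (msupp a) _) (fsubset_refl _)).
rewrite -big_split /=; apply: eq_bigr => x _.
rewrite -big_split /=; apply: eq_bigr => y _.
by rewrite mcoeffD mulrDl monalgUD.
Qed.

Lemma galg_mulDr : right_distributive galg_mul +%R.
Proof.
move=> c a b; rewrite (galg_mulEw (fsubset_refl _) (msuppD_le a b)).
rewrite (galg_mulEw (fsubset_refl _) (fsubsetUl _ (msupp b))).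
rewrite (galg_mulEw (fsubset_refl _) (fsubsetUr (msupp a) _)).
rewrite -big_split /=; apply: eq_bigr => x _.
rewrite -big_split /=; apply: eq_bigr => y _.
by rewrite mcoeffD mulrDr monalgUD.
Qed.

Lemma galg_mul0r : left_zero 0 galg_mul.
Proof. by move=> a; rewrite /galg_mul msupp0 big_seq_fset0. Qed.

Lemma galg_mulr0 : right_zero 0 galg_mul.
Proof.
by move=> a; rewrite /galg_mul big1 // => x _; rewrite msupp0 big_seq_fset0.
Qed.

Lemma galg_mulUU (c d : k) x y :
  galg_mul << c *g x >> << d *g y >> = << c * d *g (x * y)%g >>.
Proof. by rewrite (galg_mulEw msuppU_le msuppU_le) !big_seq_fset1 !mcoeffUU. Qed.

Lemma galg_mul_suml (I : Type) (r : seq I) (F : I -> galg k G) b :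
  galg_mul (\sum_(i <- r) F i) b = \sum_(i <- r) galg_mul (F i) b.
Proof.
exact: (big_morph (galg_mul^~ b) (fun a a' => galg_mulDl a a' b) (galg_mul0r b)).
Qed.

Lemma galg_mul_sumr (I : Type) (r : seq I) (F : I -> galg k G) a :
  galg_mul a (\sum_(i <- r) F i) = \sum_(i <- r) galg_mul a (F i).
Proof. exact: (big_morph (galg_mul a) (galg_mulDr a) (galg_mulr0 a)). Qed.

Lemma galg_mulA : associative galg_mul.
Proof.
move=> a b c; rewrite [a]monalgE.
rewrite [LHS]galg_mul_suml [X in _ = galg_mul X _]galg_mul_suml.
rewrite [RHS]galg_mul_suml; apply: eq_bigr => x _; rewrite [b]monalgE.
rewrite [X in _ = galg_mul X _]galg_mul_sumr [RHS]galg_mul_suml.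
rewrite [X in galg_mul _ X = _]galg_mul_suml [LHS]galg_mul_sumr.
apply: eq_bigr => y _; rewrite [c]monalgE [RHS]galg_mul_sumr.
rewrite [X in galg_mul _ X = _]galg_mul_sumr [LHS]galg_mul_sumr.
apply: eq_bigr => z _.
by rewrite !galg_mulUU mulrA mulgA.
Qed.

Lemma galg_mul1r : left_id (gelt 1%g) galg_mul.
Proof.
move=> a; rewrite [a]monalgE galg_mul_sumr; apply: eq_bigr => x _.
by rewrite galg_mulUU mul1r mul1g.
Qed.

Lemma galg_mulr1 : right_id (gelt 1%g) galg_mul.
Proof.
move=> a; rewrite [a]monalgE galg_mul_suml; apply: eq_bigr => x _.
by rewrite galg_mulUU mulr1 mulg1.
Qed.

Lemma gelt1_neq0 : gelt 1%g != 0.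
Proof. by rewrite monalgU_eq0 oner_eq0. Qed.

HB.instance Definition _ := GRing.Zmodule_isNzRing.Build (galg k G)
  galg_mulA galg_mul1r galg_mulr1 galg_mulDl galg_mulDr gelt1_neq0.

Lemma galg1E : 1 = gelt 1%g. Proof. by []. Qed.

Lemma galgU_mul (c d : k) x y :
  (<< c *g x >> : galg k G) * (<< d *g y >> : galg k G) =
  << c * d *g (x * y)%g >>.
Proof. exact: galg_mulUU. Qed.

End GroupAlgebra.

Section GroupAlgebraMap.
Context (k : fieldType) (K L : groupType) (f : {multiplicative K -> L}).

Definition galg_map (a : galg k K) : galg k L := mpush f a.

HB.instance Definition _ :=
  GRing.isZmodMorphism.Build (galg k K) (galg k L) galg_map
    (mpush_is_zmod_morphism f).

Lemma galg_mapU (c : k) x : galg_map << c *g x >> = << c *g f x >>.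
Proof. exact: mpushU. Qed.

Lemma galg_map_is_monoid_morphism : monoid_morphism galg_map.
Proof.
split=> [|a b].
  rewrite !galg1E galg_mapU; congr mkmalgU.
  by apply: (@mulgI _ (f 1%g)); rewrite -gmulfM !mulg1.
rewrite [a]monalgE mulr_suml !raddf_sum mulr_suml; apply: eq_bigr => x _.
rewrite [b]monalgE mulr_sumr !raddf_sum mulr_sumr; apply: eq_bigr => y _.
by rewrite /= galgU_mul !galg_mapU galgU_mul gmulfM.
Qed.

HB.instance Definition _ :=
  GRing.isMonoidMorphism.Build (galg k K) (galg k L) galg_map
    galg_map_is_monoid_morphism.

End GroupAlgebraMap.
Arguments galg_map k {K L} f a.

(* V with scalars restricted along phi. *)
Definition resmod (R S : nzRingType) (phi : {rmorphism R -> S})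
  (V : lmodType S) : Type := V.

Section RestrictScalars.
Context (R S : nzRingType) (phi : {rmorphism R -> S}) (V : lmodType S).

HB.instance Definition _ := GRing.Zmodule.on (resmod phi V).

Definition res_scale (a : R) (v : resmod phi V) : resmod phi V :=
  phi a *: (v : V).

Lemma res_scaleA a b v : res_scale a (res_scale b v) = res_scale (a * b) v.
Proof. by rewrite /res_scale scalerA rmorphM. Qed.

Lemma res_scale1 : left_id 1 res_scale.
Proof. by move=> v; rewrite /res_scale rmorph1 scale1r. Qed.

Lemma res_scaleDr : right_distributive res_scale +%R.
Proof. by move=> a u v; rewrite /res_scale scalerDr. Qed.

Lemma res_scaleDl v : {morph res_scale^~ v : a b / a + b}.
Proof. by move=> a b; rewrite /res_scale rmorphD scalerDl. Qed.

HB.instance Definition _ := GRing.Zmodule_isLmodule.Build R (resmod phi V)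
  res_scaleA res_scale1 res_scaleDr res_scaleDl.

End RestrictScalars.

Section SubModule.
Context (R : nzRingType) (V : lmodType R) (U : submodClosed V).

Lemma submod_zmod_closed : zmod_closed U.
Proof.
split=> [|u v uU vU]; first exact: rpred0.
by rewrite -[v]scale1r -scaleNr rpredD // rpredZ.
Qed.

Definition submod := {v : V | v \in U}.

HB.instance Definition _ := SubChoice.on submod.
HB.instance Definition _ :=
  GRing.SubChoice_isSubZmodule.Build V _ submod submod_zmod_closed.
HB.instance Definition _ := [SubZmodule_isSubLmodule of submod by <:].

Definition submod_pred : {pred V} := fun v => v \in U.
HB.instance Definition _ :=
  GRing.isZmodClosed.Build V submod_pred submod_zmod_closed.

Definition quotmod := Quotient.quot submod_pred.
End SubModule.

Section QuotientAction.
Context (R : nzRingType) (A : zmodType) (I : zmodClosed A).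
Context (act : R -> A -> A).
Hypothesis actB : forall r, zmod_morphism (act r).
Hypothesis actI : forall r x, x \in I -> act r x \in I.

Definition quot_act (r : R) (q : Quotient.quot I) : Quotient.quot I :=
  \pi_(Quotient.quot I) (act r (repr q)).

Lemma quot_eqP (x y : A) :
  reflect (\pi_(Quotient.quot I) x = \pi_(Quotient.quot I) y) (x - y \in I).
Proof. by rewrite Quotient.idealrBE; apply: eqP. Qed.

Lemma quot_actE r x : quot_act r (\pi_(Quotient.quot I) x) = \pi_(Quotient.quot I) (act r x).
Proof.
by apply/quot_eqP; rewrite -actB; apply/actI/quot_eqP; rewrite reprK.
Qed.

Lemma quot_actDr : right_distributive quot_act +%R.
Proof.
have actD r x y : act r (x + y) = act r x + act r y.
  have act0 : act r 0 = 0 by rewrite -[X in act r X](subrr 0) actB subrr.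
  have actN z : act r (- z) = - act r z.
    by rewrite -[X in act r X]sub0r actB act0 sub0r.
  by rewrite -[y]opprK actB !actN.
move=> r p q; rewrite -[p]reprK -[q]reprK -raddfD /= !quot_actE actD.
by rewrite raddfD.
Qed.
End QuotientAction.

Section QuotientModule.
Context (R : nzRingType) (V : lmodType R) (U : submodClosed V).

HB.instance Definition _ := ZmodQuotient.on (quotmod U).

Definition quotmod_scale : R -> quotmod U -> quotmod U :=
  @quot_act R V (submod_pred U) *:%R.

Let scale_zmod_morphism (r : R) : zmod_morphism ( *:%R r : V -> V).
Proof. by move=> x y; apply: scalerBr. Qed.

Let scale_submod (r : R) (x : V) :
  x \in submod_pred U -> r *: x \in submod_pred U.
Proof. by rewrite !unfold_in => xU; apply: (@rpredZ _ _ U). Qed.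

Lemma quotmod_scaleE r (v : V) :
  quotmod_scale r (\pi_(quotmod U) v) = \pi_(quotmod U) (r *: v).
Proof. exact: (quot_actE scale_zmod_morphism scale_submod). Qed.

Lemma quotmod_scaleA a b q :
  quotmod_scale a (quotmod_scale b q) = quotmod_scale (a * b) q.
Proof.
elim/quotW: q => v.
by rewrite [quotmod_scale b _]quotmod_scaleE !quotmod_scaleE scalerA.
Qed.

Lemma quotmod_scale1 : left_id 1 quotmod_scale.
Proof. by elim/quotW=> v; rewrite quotmod_scaleE scale1r. Qed.

Lemma quotmod_scaleDr : right_distributive quotmod_scale +%R.
Proof. exact: (quot_actDr scale_zmod_morphism scale_submod). Qed.

Lemma quotmod_scaleDl q : {morph quotmod_scale^~ q : a b / a + b}.
Proof.
move=> a b; elim/quotW: q => v.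
by rewrite /= !quotmod_scaleE scalerDl raddfD.
Qed.

HB.instance Definition _ := GRing.Zmodule_isLmodule.Build R (quotmod U)
  quotmod_scaleA quotmod_scale1 quotmod_scaleDr quotmod_scaleDl.

End QuotientModule.

Section SubQuotient.
Context (R : nzRingType) (V : lmodType R) (B A : submodClosed V).

Definition sub_in : {pred submod B} := fun v => \val v \in A.

Lemma sub_in_closed : submod_closed sub_in.
Proof.
split=> [|a u v uA vA]; first exact: (rpred0 A).
by rewrite unfold_in /= rpredD // rpredZ.
Qed.

HB.instance Definition _ :=
  GRing.isSubmodClosed.Build R (submod B) sub_in sub_in_closed.

(* B / (A :&: B), that is B / A when A is contained in B. *)
Definition subquot : lmodType R := quotmod sub_in.
End SubQuotient.

Definition irreducible (R : nzRingType) (V : lmodType R) : Prop :=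
  (exists v : V, v != 0) /\
  forall U : submodClosed V,
    (forall v, v \in U -> v = 0) \/ (forall v, v \in U).

Definition mod_iso (R : nzRingType) (V W : lmodType R) : Prop :=
  exists f : {linear V -> W}, bijective f.

Definition composition_series (R : nzRingType) (V : lmodType R) (n : nat)
    (S : nat -> submodClosed V) : Prop :=
  [/\ S 0%N =i pred1 0, S n =i predT &
      forall i, (i < n)%N ->
        {subset S i <= S i.+1} /\ irreducible (subquot (S i.+1) (S i))].

Definition composition_factor (R : nzRingType) (V X : lmodType R) : Prop :=
  exists n S i, [/\ @composition_series R V n S, (i < n)%N &
                    mod_iso X (subquot (S i.+1) (S i))].

Definition common_composition_factor (R : nzRingType) (V W : lmodType R) :=
  exists X : lmodType R, composition_factor V X /\ composition_factor W X.

(* Extension of scalars S (x)_R M along phi : R -> S: the free abelian group  *)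
(* on S x M modulo the subgroup generated by the relations of a balanced      *)
(* biadditive map, with S acting on the left factor.                          *)

Section ExtendScalars.
Context (R S : nzRingType) (phi : {rmorphism R -> S}) (M : lmodType R).

Local Notation F := {malg int[(S * M)%type]}.

Definition tgen (s : S) (m : M) : F := << (s, m) >>.

Variant tensor_relation : F -> Prop :=
| TensorAddl s s' m : tensor_relation (tgen (s + s') m - tgen s m - tgen s' m)
| TensorAddr s m m' : tensor_relation (tgen s (m + m') - tgen s m - tgen s m')
| TensorBalanced s r m :
    tensor_relation (tgen (s * phi r) m - tgen s (r *: m)).

Definition tensor_sub : {pred F} := fun x =>
  `[< forall I : zmodClosed F,
        (forall y, tensor_relation y -> y \in I) -> x \in I >].

Lemma tensor_sub_closed : zmod_closed tensor_sub.
Proof.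
split=> [|x y /asboolP xT /asboolP yT]; apply/asboolP => I hI.
  exact: rpred0.
by rewrite rpredB ?xT ?yT.
Qed.

HB.instance Definition _ := GRing.isZmodClosed.Build F tensor_sub
  tensor_sub_closed.

Lemma tensor_subP x : tensor_relation x -> x \in tensor_sub.
Proof. by move=> xr; apply/asboolP => I; apply. Qed.

Lemma tensor_sub_ind (I : zmodClosed F) :
  (forall y, tensor_relation y -> y \in I) -> {subset tensor_sub <= I}.
Proof. by move=> hI x /asboolP; apply. Qed.

Definition extmod := Quotient.quot tensor_sub.

HB.instance Definition _ := ZmodQuotient.on extmod.

Definition tensor (s : S) (m : M) : extmod := \pi_extmod (tgen s m).

Definition tact (s : S) : F -> F := mpush (fun p => (s * p.1, p.2)).

Lemma tact_gen s t m : tact s (tgen t m) = tgen (s * t) m.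
Proof. exact: mpushU. Qed.

Lemma tact_is_zmod_morphism s : zmod_morphism (tact s).
Proof. exact: mpush_is_zmod_morphism. Qed.

HB.instance Definition _ s :=
  GRing.isZmodMorphism.Build F F (tact s) (tact_is_zmod_morphism s).

Section Preimage.
Variable s : S.
Definition tact_pre : {pred F} := fun x => tact s x \in tensor_sub.
Lemma tact_pre_closed : zmod_closed tact_pre.
Proof.
by split=> [|x y xP yP]; rewrite unfold_in /= ?raddf0 ?raddfB ?rpred0 ?rpredB.
Qed.
HB.instance Definition _ := GRing.isZmodClosed.Build F tact_pre tact_pre_closed.
End Preimage.

Lemma tact_sub s x : x \in tensor_sub -> tact s x \in tensor_sub.
Proof.
apply: (@tensor_sub_ind (tact_pre s)) => y yr; rewrite unfold_in /=.
apply: tensor_subP; case: yr => *; rewrite !raddfB /= !tact_gen.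
- by rewrite mulrDr; apply: TensorAddl.
- exact: TensorAddr.
- by rewrite mulrA; apply: TensorBalanced.
Qed.

Definition ext_scale : S -> extmod -> extmod := quot_act tact.

Lemma ext_scaleE s x : ext_scale s (\pi_extmod x) = \pi_extmod (tact s x).
Proof. exact: (quot_actE tact_is_zmod_morphism tact_sub). Qed.

Lemma ext_scaleDr : right_distributive ext_scale +%R.
Proof. exact: (quot_actDr tact_is_zmod_morphism tact_sub). Qed.

Lemma malg_int_gen (c : int) (p : (S * M)%type) :
  << c *g p >> = << p >> *~ c :> F.
Proof. by rewrite -raddfMz /= -mulrzr mul1r intz. Qed.

Lemma ext_ind (P : extmod -> Prop) :
    P 0 -> (forall p q, P p -> P q -> P (p + q)) -> (forall p, P p -> P (- p)) ->
    (forall s m, P (tensor s m)) -> forall q, P q.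
Proof.
move=> P0 PD PN Pt q; rewrite -[q]reprK [repr q]monalgE raddf_sum.
apply: (big_ind P) => // -[s m] _; rewrite malg_int_gen raddfMz /=.
have Pn n : P (tensor s m *+ n).
  by elim: n => // n IH; rewrite mulrS; apply: PD.
by case: (_@__) => n; [apply: Pn | apply/PN/Pn].
Qed.

Lemma ext_scale_tensor s t m : ext_scale s (tensor t m) = tensor (s * t) m.
Proof. by rewrite ext_scaleE tact_gen. Qed.

Lemma ext_scaleB s : zmod_morphism (ext_scale s).
Proof.
move=> p q; have sD := ext_scaleDr s.
have s0 : ext_scale s 0 = 0 by apply: (addrI (ext_scale s 0)); rewrite -sD !addr0.
rewrite sD; congr (_ + _); apply: (addrI (ext_scale s q)).
by rewrite -sD !subrr.
Qed.

Lemma ext_eq (B : zmodType) (u v : extmod -> B) :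
    zmod_morphism u -> zmod_morphism v ->
    (forall s m, u (tensor s m) = v (tensor s m)) -> u =1 v.
Proof.
move=> uB vB uv.
have u0 : u 0 = 0 by have := uB 0 0; rewrite !subrr.
have v0 : v 0 = 0 by have := vB 0 0; rewrite !subrr.
have uN p : u (- p) = - u p by have := uB 0 p; rewrite sub0r u0 sub0r.
have vN p : v (- p) = - v p by have := vB 0 p; rewrite sub0r v0 sub0r.
apply: ext_ind => //= [|p q up uq|p up]; first by rewrite u0 v0.
  have := uB p (- q); have := vB p (- q); rewrite !opprK => -> ->.
  by rewrite uN vN up uq.
by rewrite uN vN up.
Qed.

Lemma tensorDl s t m : tensor (s + t) m = tensor s m + tensor t m.
Proof.
rewrite /tensor -raddfD; apply/quot_eqP; rewrite opprD addrA.
exact/tensor_subP/TensorAddl.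
Qed.

Lemma tensorDr s m n : tensor s (m + n) = tensor s m + tensor s n.
Proof.
rewrite /tensor -raddfD; apply/quot_eqP; rewrite opprD addrA.
exact/tensor_subP/TensorAddr.
Qed.

Lemma tensor_balanced s r m : tensor (s * phi r) m = tensor s (r *: m).
Proof. exact/quot_eqP/tensor_subP/TensorBalanced. Qed.

Lemma ext_scaleA s t q : ext_scale s (ext_scale t q) = ext_scale (s * t) q.
Proof.
apply: (ext_eq (u := ext_scale s \o ext_scale t)) => {q} [p q||r m] /=.
- by rewrite !ext_scaleB.
- exact: ext_scaleB.
- by rewrite [ext_scale t _]ext_scale_tensor !ext_scale_tensor mulrA.
Qed.

Lemma ext_scale1 : left_id 1 ext_scale.
Proof.
apply: ext_eq => // [|s m]; first exact: ext_scaleB.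
by rewrite ext_scale_tensor mul1r.
Qed.

Lemma ext_scaleDl q : {morph ext_scale^~ q : s t / s + t}.
Proof.
move=> s t; apply: (ext_eq (v := fun q => ext_scale s q + ext_scale t q)) => {q}.
- exact: ext_scaleB.
- by move=> p q; rewrite !ext_scaleB opprD addrACA.
- by move=> r m; rewrite !ext_scale_tensor mulrDl tensorDl.
Qed.

HB.instance Definition _ := GRing.Zmodule_isLmodule.Build S extmod
  ext_scaleA ext_scale1 ext_scaleDr ext_scaleDl.

Lemma scale_tensor s t m : s *: tensor t m = tensor (s * t) m.
Proof. exact: ext_scale_tensor. Qed.

Section Universal.
Context (B : zmodType) (g : S -> M -> B).
Hypotheses (gDl : forall s t m, g (s + t) m = g s m + g t m)
  (gDr : forall s m n, g s (m + n) = g s m + g s n)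
  (gZ : forall s r m, g (s * phi r) m = g s (r *: m)).

Let lift_free (x : F) : B := \sum_(p <- msupp x) g p.1 p.2 *~ x@_p.

Let lift_freeE (d : {fset (S * M)%type}) x : (msupp x `<=` d)%fset ->
  lift_free x = \sum_(p <- d) g p.1 p.2 *~ x@_p.
Proof.
by move=> le; rewrite /lift_free (big_fset_incl _ le) //= => p _ /mcoeff_outdom ->.
Qed.

Let lift_free_gen s m : lift_free (tgen s m) = g s m.
Proof. by rewrite (lift_freeE msuppU_le) big_seq_fset1 mcoeffUU. Qed.

Let lift_freeB : zmod_morphism lift_free.
Proof.
move=> x y; rewrite (lift_freeE (msuppB_le x y)).
rewrite (lift_freeE (fsubsetUl _ (msupp y))).
rewrite (lift_freeE (fsubsetUr (msupp x) _)) -sumrB.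
by apply: eq_bigr => p _; rewrite mcoeffB mulrzBr.
Qed.

Let lift_ker : {pred F} := fun x => lift_free x == 0.

Let lift_ker_closed : zmod_closed lift_ker.
Proof.
split=> [|x y /eqP x0 /eqP y0]; rewrite unfold_in /=.
  by have := lift_freeB 0 0; rewrite !subrr => ->.
by rewrite lift_freeB x0 y0 subrr.
Qed.

HB.instance Definition _ := GRing.isZmodClosed.Build F lift_ker lift_ker_closed.

Lemma extmod_universal :
  exists h : {additive extmod -> B}, forall s m, h (tensor s m) = g s m.
Proof.
have ker x : x \in tensor_sub -> lift_free x = 0.
  move=> xT; apply/eqP; apply: (@tensor_sub_ind lift_ker) x xT => y yr.
  rewrite unfold_in /=; case: yr => *; rewrite !lift_freeB !lift_free_gen.
  - by rewrite gDl addrAC addrK subrr.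
  - by rewrite gDr addrAC addrK subrr.
  - by rewrite gZ subrr.
pose h (q : extmod) := lift_free (repr q).
have hE x : h (\pi_extmod x) = lift_free x.
  apply/eqP; rewrite -subr_eq0 -lift_freeB ker //.
  by apply/quot_eqP; rewrite reprK.
have hB : zmod_morphism h.
  by elim/quotW=> x; elim/quotW=> y; rewrite -raddfB !hE lift_freeB.
pose hM := GRing.isZmodMorphism.Build extmod B h hB.
pose hA : {additive extmod -> B} := HB.pack h hM.
by exists hA => s m; rewrite /= hE lift_free_gen.
Qed.
End Universal.

End ExtendScalars.

Section SubGroups.
Context (G : groupType).
Implicit Types (H : groupClosed G).

Lemma group_closedP H : group_closed H.
Proof. by split=> [|x y xH yH]; [apply: gpred1 | apply: gpredF]. Qed.

Definition subgrp H := {x : G | x \in H}.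

HB.instance Definition _ H := SubChoice.on (subgrp H).
HB.instance Definition _ H :=
  SubChoice_isSubGroup.Build G _ (subgrp H) (group_closedP H).

Definition subgrp_incl H : {multiplicative subgrp H -> G} :=
  (\val : subgrp H -> G).

(* H :&: A as a subgroup of the group H. *)
Definition capH H (A : groupClosed G) : {pred subgrp H} :=
  fun x => \val x \in A.
Arguments capH : clear implicits.

Lemma capH_mulg_closed H A : mulg_closed (capH H A).
Proof. by move=> x y; rewrite !unfold_in /= => xA yA; apply: (gpredM (s := A)). Qed.

Lemma capH_group1 H A : 1%g \in capH H A.
Proof. by rewrite unfold_in; apply: (gpred1 : 1%g \in A). Qed.

Lemma capH_invg_closed H A : invg_closed (capH H A).
Proof. by move=> x; rewrite !unfold_in /= => xA; apply: (gpredVr (s := A)). Qed.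

HB.instance Definition _ H A :=
  isMulClosed.Build (subgrp H) (capH H A) (@capH_mulg_closed H A).
HB.instance Definition _ H A :=
  isMul1Closed.Build (subgrp H) (capH H A) (@capH_group1 H A).
HB.instance Definition _ H A :=
  isInvClosed.Build (subgrp H) (capH H A) (@capH_invg_closed H A).

(* s H s^-1 :&: H :&: A; recall that g ^ s = s^-1 * (g * s). *)
Definition conj_cap H (A : groupClosed G) (s : G) : {pred G} :=
  fun g => [&& (g ^ s)%g \in H, g \in H & g \in A].

Lemma conj_cap_mulg_closed H A s : mulg_closed (conj_cap H A s).
Proof.
move=> x y /and3P[xs xH xA] /and3P[ys yH yA].
by rewrite unfold_in conjMg; apply/and3P; split; apply: gpredM.
Qed.

Lemma conj_cap_group1 H A s : 1%g \in conj_cap H A s.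
Proof. by rewrite unfold_in conj1g; apply/and3P; split; apply: gpred1. Qed.

Lemma conj_cap_invg_closed H A s : invg_closed (conj_cap H A s).
Proof.
by move=> x /and3P[xs xH xA]; rewrite unfold_in conjVg !gpredV xs xH xA.
Qed.

HB.instance Definition _ H A s :=
  isMulClosed.Build G (conj_cap H A s) (@conj_cap_mulg_closed H A s).
HB.instance Definition _ H A s :=
  isMul1Closed.Build G (conj_cap H A s) (@conj_cap_group1 H A s).
HB.instance Definition _ H A s :=
  isInvClosed.Build G (conj_cap H A s) (@conj_cap_invg_closed H A s).

End SubGroups.
Arguments capH {G} H A.

Section SubGroupMorphisms.
Context (G : groupType) (H A : groupClosed G) (s : G).

Lemma conj_capH (g : subgrp (conj_cap H A s)) : \val g \in H.
Proof. by case/and3P: (valP g). Qed.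

Lemma conj_capA (g : subgrp (conj_cap H A s)) : \val g \in A.
Proof. by case/and3P: (valP g). Qed.

Lemma conj_capJ (g : subgrp (conj_cap H A s)) : (\val g ^ s)%g \in H.
Proof. by case/and3P: (valP g). Qed.

Lemma conj_capJA (sA : s \in A) (g : subgrp (conj_cap H A s)) :
  (\val g ^ s)%g \in A.
Proof. by rewrite gpredJ // conj_capA. Qed.

Definition conj_incl (g : subgrp (conj_cap H A s)) : subgrp (capH H A) :=
  exist _ (exist _ (\val g) (conj_capH g)) (conj_capA g).

Lemma conj_inclM : {morph conj_incl : x y / (x * y)%g}.
Proof. by move=> x y; do 2!apply: val_inj. Qed.

HB.instance Definition _ :=
  monoid.isMultiplicative.Build _ _ conj_incl conj_inclM.

(* s A s^-1 = A as s lies in A, so g |-> s^-1 g s maps the group above into   *)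
(* H :&: A; restricting along it an (H :&: A)-module M_i gives M_(i,s).       *)
Definition conj_twist (sA : s \in A) (g : subgrp (conj_cap H A s)) :
    subgrp (capH H A) :=
  exist _ (exist _ (\val g ^ s)%g (conj_capJ g)) (conj_capJA sA g).

Lemma conj_twistM sA : {morph conj_twist sA : x y / (x * y)%g}.
Proof. by move=> x y; do 2!apply: val_inj; rewrite /= conjMg. Qed.

HB.instance Definition _ (sA : s \in A) :=
  monoid.isMultiplicative.Build _ _ (conj_twist sA) (conj_twistM sA).

End SubGroupMorphisms.
Arguments conj_incl {G} H A s g.
Arguments conj_twist {G} H A {s} sA g.

(* A kL-module as a kK-module along a group morphism K -> L. *)
Definition resgrp (k : fieldType) (K L : groupType)
    (f : {multiplicative K -> L}) (V : lmodType (galg k L)) :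
    lmodType (galg k K) :=
  resmod (galg_map k f) V.

(* kG (x)_kH M, where kH acts on kG by right multiplication. *)
Definition Ind (k : fieldType) (G : groupType) (H : groupClosed G)
    (M : lmodType (galg k (subgrp H))) : lmodType (galg k G) :=
  extmod (galg_map k (subgrp_incl H)) M.
Arguments Ind {k G} H M.

(* Sequences are indexed from 0 instead of 1. *)

Definition quasi_finite_seq (G : groupType) (Gs : nat -> groupClosed G) : Prop :=
  [/\ forall i, finite_set [set x | x \in Gs i],
      forall x, exists i, x \in Gs i &
      forall i j, exists r, {subset Gs i <= Gs r} /\ {subset Gs j <= Gs r}].

Definition induced_seq (G : groupType) (H : groupClosed G)
    (Gs : nat -> groupClosed G) (i : nat) : groupClosed (subgrp H) :=
  capH H (Gs i).

Definition quasi_finite_mod_seq (k : fieldType) (K : groupType)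
    (Ks : nat -> groupClosed K) (N : lmodType (galg k K))
    (Ns : forall i, submodClosed (resgrp (subgrp_incl (Ks i)) N)) : Prop :=
  [/\ forall i, irreducible (submod (Ns i)),
      forall i j, {subset Ks i <= Ks j} ->
        forall v : N, v \in Ns i -> v \in Ns j &
      forall v : N, exists i, v \in Ns i].

(* Main.v *)
Require Import Defs.
From HB Require Import structures.
From mathcomp Require Import all_boot all_algebra finmap.
From mathcomp Require Import boolp classical_sets cardinality.
From mathcomp.multinomials Require Import monalg.

Set Implicit Arguments.
Unset Strict Implicit.
Unset Printing Implicit Defensive.

Import GRing.Theory.
Local Open Scope ring_scope.
Local Open Scope quotient_scope.

(* Write A = G_r and N = M_r.  A nonzero u in a submodule U of Ind_H^G M lies *)
(* in W = kA N for some r.  Maschke's theorem for the finite group A gives an *)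
(* A-linear projector p of Ind_H^G M onto the intersection of U and W.  For s *)
(* in A outside H, the component of p(1 (x) m) at the coset sH is a           *)
(* homomorphism from N to its twist N_s, hence vanishes, as a nonzero         *)
(* homomorphism between modules of finite length produces a common            *)
(* composition factor.  Thus p maps 1 (x) N into itself and into U, and       *)
(* irreducibility of N leaves two cases: either p vanishes on 1 (x) N, hence  *)
(* on W, contradicting p u = u; or U contains 1 (x) N, hence 1 (x) M, hence   *)
(* everything.                                                                *)

(** * Finite length and composition factors *)

(** This is Mackey's irreducibility criterion carried out inside one finite group at a time. An
    element of the induced module is a finite sum of tensors, so directedness
    ([quasi_finite_common_index]) places it in kA N for a single level, where A is finite and N is
    an irreducible module of the intersection of H and A. There [Maschke] supplies an A-linear
    projector onto the part of the submodule U lying in kA N.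

    The proof reads that projector through the coset coordinates [ind_coord]. Its component at a
    coset sH other than H intertwines N with its twist. [hom_common_factor] turns a nonzero
    component into a common composition factor, the finite length it requires coming from
    [resgrp_finite_length]. So condition (2) makes the projector diagonal on 1 (x) N, and the
    irreducibility of N gives the alternative exploited in [level_incl_in_submod]: a nonzero U meets
    1 (x) M nontrivially. Irreducibility of M then forces U to be everything. *)

Section SubmodClosed.
Context (R : nzRingType) (V : lmodType R).

Lemma submod_of_prop (P : V -> Prop) :
    P 0 -> (forall a u v, P u -> P v -> P (a *: u + v)) ->
  {U : submodClosed V | forall v, v \in U <-> P v}.
Proof.
move=> P0 PD; pose p : {pred V} := fun v => `[< P v >].
have pC : GRing.submod_closed p.
  by split=> [|a u v /asboolP Pu /asboolP Pv]; apply/asboolP => //; apply: PD.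
pose pM := GRing.isSubmodClosed.Build R V p pC.
pose U : submodClosed V := HB.pack p pM.
by exists U => v; split=> /asboolP.
Qed.

Definition submod0 : submodClosed V.
apply: (sval (@submod_of_prop (fun v => v = 0) _ _)) => //.
by move=> a u v -> ->; rewrite scaler0 addr0.
Defined.

Lemma submod0P v : v \in submod0 <-> v = 0.
Proof. by rewrite /submod0; case: submod_of_prop => U /= UP. Qed.

Definition submodT : submodClosed V.
by apply: (sval (@submod_of_prop (fun v => True) _ _)).
Defined.

Lemma submodTP v : v \in submodT.
Proof. by rewrite /submodT; case: submod_of_prop => U /= UP; apply/UP. Qed.

End SubmodClosed.
Arguments submod0 {R V}.
Arguments submodT {R V}.

Section FiniteLength.
Context (R : nzRingType) (V : lmodType R).
Implicit Types A B C : submodClosed V.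

(** A strictly monotone rank on submodules replaces a bound on the lengths of chains. In this form
    the property is inherited at once by any structure with fewer submodules. *)
Definition finite_length := exists d : submodClosed V -> nat,
  forall A B, {subset A <= B} ->
    (d A <= d B)%N /\ ((d B <= d A)%N -> {subset B <= A}).

Definition covers A B := [/\ {subset A <= B}, ~ {subset B <= A} &
  forall C, {subset A <= C} -> {subset C <= B} ->
    {subset C <= A} \/ {subset B <= C}].

Fixpoint covering A (l : seq (submodClosed V)) : Prop :=
  if l is B :: l' then covers A B /\ covering B l' else True.

Lemma covering_cat A l1 l2 :
  covering A (l1 ++ l2) <-> covering A l1 /\ covering (last A l1) l2.
Proof. by elim: l1 A => [|B l IH] A /=; rewrite ?IH; tauto. Qed.

Lemma covering_nth D A l i : covering A l -> (i < size l)%N ->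
  covers (nth D (A :: l) i) (nth D (A :: l) i.+1).
Proof.
by elim: l A i => [|B l IH] A [|i] //= [AB Bl] il //; apply: IH.
Qed.
End FiniteLength.

Section QuotientFacts.
Context (R : nzRingType) (V : lmodType R) (U : submodClosed V).

Definition quotmod_pi (v : V) : quotmod U := \pi_(quotmod U) v.

Lemma quotmod_pi_linear : linear quotmod_pi.
Proof.
move=> a u v; rewrite /quotmod_pi raddfD; congr (_ + _).
by apply/esym/quotmod_scaleE.
Qed.

HB.instance Definition _ :=
  GRing.isLinear.Build R V (quotmod U) *:%R quotmod_pi quotmod_pi_linear.

Lemma quotmod_pi_eq0 v : quotmod_pi v = 0 <-> v \in U.
Proof.
have -> : 0 = quotmod_pi 0 by rewrite /quotmod_pi raddf0.
split=> [/quot_eqP|vU]; first by rewrite subr0.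
by apply/quot_eqP; rewrite subr0.
Qed.

Lemma quotmod_pi_surj q : exists v, quotmod_pi v = q.
Proof. by exists (repr q); apply: reprK. Qed.
End QuotientFacts.

Lemma submod_val_linear (R : nzRingType) (V : lmodType R) (U : submodClosed V) :
  linear (\val : submod U -> V).
Proof. by move=> a u v; rewrite linearP. Qed.

Section Covers.
Context (R : nzRingType) (V : lmodType R).
Implicit Types A B C : submodClosed V.

Lemma not_subset_ex A B : ~ {subset B <= A} -> exists2 v, v \in B & v \notin A.
Proof.
move=> nBA; apply: contrapT => nex; apply: nBA => v vB; apply: contrapT => vA.
by apply: nex; exists v => //; apply/negP.
Qed.

(** A submodule of B / A pulls back to a submodule [C] between A and B, which minimality forces to
    be one of the two ends. *)
Lemma covers_irreducible A B : covers A B -> irreducible (subquot B A).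
Proof.
case=> AB nBA min; split.
  have [v vB /negP vA] := not_subset_ex nBA.
  exists (quotmod_pi (sub_in (B:=B) A) (exist _ v vB)); apply/eqP.
  by move/quotmod_pi_eq0.
move=> U.
have [||C CP] := @submod_of_prop R V (fun v =>
    exists2 w : submod B, \val w = v & quotmod_pi (sub_in (B:=B) A) w \in U).
- exists 0; first by rewrite raddf0.
  by have /quotmod_pi_eq0 -> := rpred0 (sub_in (B:=B) A); apply: rpred0.
- move=> a _ _ [u <- uU] [v <- vU]; exists (a *: u + v).
    exact: submod_val_linear.
  by rewrite linearP rpredD ?rpredZ.
case: (min C).
- move=> v vA; apply/CP; exists (exist _ v (AB _ vA)) => //.
  have -> : quotmod_pi (sub_in (B:=B) A) (exist _ v (AB _ vA)) = 0.
    by apply/quotmod_pi_eq0.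
  exact: rpred0.
- by move=> v /CP[w <- _]; apply: (valP w).
- move=> CA; left=> q; have [w <-] := quotmod_pi_surj q => wU.
  by apply/quotmod_pi_eq0; apply: CA; apply/CP; exists w.
move=> BC; right=> q; have [w <-] := quotmod_pi_surj q.
by have /CP[w' /val_inj ->] := BC _ (valP w).
Qed.

(** Induction on the rank difference: if the step from A to B is not already a cover, some C lies
    strictly between, both halves have smaller rank difference, and their chains are
    concatenated. *)
Lemma ex_covering A B : finite_length V -> {subset A <= B} ->
  ~ {subset B <= A} -> exists l, covering A (rcons l B).
Proof.
case=> d dP; have [n] := ubnP (d B - d A)%N; elim: n A B => // n IH A B ltn AB nBA.
have [cAB|ncAB] := pselect (covers A B); first by exists [::].
have [C [AC CB nCA nBC]] : exists C, [/\ {subset A <= C}, {subset C <= B},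
    ~ {subset C <= A} & ~ {subset B <= C}].
  apply: contrapT => nex; apply: ncAB; split=> // C AC CB.
  have [CA|nCA] := pselect {subset C <= A}; first by left.
  have [BC|nBC] := pselect {subset B <= C}; first by right.
  by case: nex; exists C.
have dAC : (d A < d C)%N by rewrite ltnNge; apply/negP => /(dP _ _ AC).2.
have dCB : (d C < d B)%N by rewrite ltnNge; apply/negP => /(dP _ _ CB).2.
have [|l1 l1P] := IH A C _ AC nCA.
  by apply: (leq_trans (ltn_sub2r _ dCB)) => //; rewrite (ltn_trans dAC).
have [|l2 l2P] := IH C B _ CB nBC.
  by apply: (leq_trans (ltn_sub2l _ dAC)) => //; rewrite (ltn_trans dAC).
exists (rcons l1 C ++ l2); rewrite rcons_cat; apply/covering_cat; split=> //.
by rewrite last_rcons.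
Qed.

(** The step from A to B is completed to a composition series by refining the inclusions of 0 in A
    and of B in V, either of which may be trivial. *)
Lemma covers_composition_factor A B :
  finite_length V -> covers A B -> composition_factor V (subquot B A).
Proof.
move=> fV cAB.
have [Z [l1 [Z0 Zl1 lA]]] : exists (Z : submodClosed V) (l1 : seq (submodClosed V)),
    [/\ Z =i pred1 (0 : V), covering Z l1 & last Z l1 = A].
  have [A0|nA0] := pselect {subset A <= submod0}.
    exists A, [::]; split=> // v; rewrite inE.
    by apply/idP/eqP => [/A0/submod0P|->]; rewrite ?rpred0.
  have [|l lP] := ex_covering (A := submod0) fV _ nA0.
    by move=> v /submod0P ->; apply: rpred0.
  exists submod0, (rcons l A); split=> //; last by rewrite last_rcons.
  by move=> v; rewrite inE; apply/idP/eqP => [/submod0P|/submod0P].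
have [l2 [Bl2 lT]] : exists l2 : seq (submodClosed V),
    covering B l2 /\ last B l2 =i predT.
  have [BT|nBT] := pselect {subset submodT <= B}.
    by exists [::]; split=> // v; apply/BT/submodTP.
  have [|l lP] := ex_covering (A := B) fV _ nBT; first by move=> v _; apply: submodTP.
  by exists (rcons l submodT); split=> // v; rewrite last_rcons; apply: submodTP.
(* [Z] has index 0, so [A], the last term of [Z :: l1], has index [size l1] and [B] comes right
   after it. *)
pose l := l1 ++ B :: l2; pose S := nth Z (Z :: l).
have lP : covering Z l by apply/covering_cat; split=> //; rewrite lA.
have SA : S (size l1) = A.
  by rewrite /S /l -cat_cons nth_cat /= ltnSn -last_nth.
have SB : S (size l1).+1 = B.
  by rewrite /S /l /= nth_cat ltnn subnn.
exists (size l), S, (size l1); split.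
- split=> //; first by rewrite /S -last_nth /l last_cat.
  move=> i il; have := covering_nth Z lP il => c.
  by split; [case: c | apply: covers_irreducible].
- by rewrite /l size_cat /= addnS ltnS leq_addr.
by rewrite SA SB; exists idfun; exists id.
Qed.

Lemma mod_iso_factor (X Y : lmodType R) :
  mod_iso X Y -> composition_factor V Y -> composition_factor V X.
Proof.
case=> f bf [n [S [i [SP lin [g bg]]]]]; exists n, S, i; split=> //.
by exists (g \o f); apply: bij_comp.
Qed.
End Covers.

Lemma subquot_iso (R : nzRingType) (V W : lmodType R) (f : {linear V -> W})
    (A B : submodClosed V) (C D : submodClosed W) :
    (forall v, v \in B -> f v \in D) ->
    (forall w, w \in D -> exists2 v, v \in B & f v = w) ->
    (forall v, v \in B -> (v \in A) = (f v \in C)) ->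
  mod_iso (subquot B A) (subquot D C).
Proof.
move=> fBD fsurj fAC.
pose h (v : submod B) : submod D := exist _ (f (\val v)) (fBD _ (valP v)).
have hlin : linear h.
  by move=> a u v; apply: val_inj; rewrite submod_val_linear /= !linearP.
pose hM := GRing.isLinear.Build R (submod B) (submod D) *:%R h hlin.
pose hL : {linear submod B -> submod D} := HB.pack h hM.
pose pB := quotmod_pi (sub_in (B:=B) A); pose pD := quotmod_pi (sub_in (B:=D) C).
have hA v : pB v = 0 <-> pD (hL v) = 0.
  have := fAC _ (valP v); rewrite -[LHS]/(v \in sub_in A).
  rewrite -[RHS]/(hL v \in sub_in C) => vE.
  by rewrite /pB /pD !quotmod_pi_eq0 vE.
pose g (q : subquot B A) : subquot D C := pD (hL (repr q)).
have gE v : g (pB v) = pD (hL v).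
  apply/eqP; rewrite -subr_eq0 -!linearB; apply/eqP/hA.
  by rewrite /pB linearB /= [quotmod_pi _ (repr _)]reprK subrr.
have glin : linear g.
  move=> a p q; have [u <-] := quotmod_pi_surj p; have [v <-] := quotmod_pi_surj q.
  have <- : pB (a *: u + v) = a *: pB u + pB v by apply: linearP.
  by rewrite !gE linearP /pD linearP.
have ginj : injective g.
  move=> p q; have [u <-] := quotmod_pi_surj p; have [v <-] := quotmod_pi_surj q.
  rewrite !gE => /eqP; rewrite -subr_eq0 -!linearB => /eqP/hA/eqP.
  by rewrite /pB linearB subr_eq0 => /eqP.
have gsurj q : exists p, g p = q.
  have [w <-] := quotmod_pi_surj q; have [v vB fv] := fsurj _ (valP w).
  exists (pB (exist _ v vB)); rewrite gE; congr (quotmod_pi _ _).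
  exact: val_inj.
pose gM := GRing.isLinear.Build R (subquot B A) (subquot D C) *:%R g glin.
pose gL : {linear subquot B A -> subquot D C} := HB.pack g gM.
have [g' g'K] := choice gsurj.
by exists gL, g' => // p; apply: ginj; rewrite g'K.
Qed.

(** Take P minimal above the kernel K of f. Then f induces an isomorphism from P / K onto f(P), and
    f(P) is simple because a submodule of it pulls back to one between K and P. Both quotients are
    therefore composition factors, one of V and one of W. *)
Lemma hom_common_factor (R : nzRingType) (V W : lmodType R)
    (f : V -> W) v :
    linear f -> finite_length V -> finite_length W -> f v != 0 ->
  common_composition_factor V W.
Proof.
move=> flin fV fW; pose fM := GRing.isLinear.Build R V W *:%R f flin.
pose fL : {linear V -> W} := HB.pack f fM.
rewrite -[f]/(fL : V -> W); move: fL => {flin fM}f fv0.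
have [||K KP] := @submod_of_prop R V (fun v => f v = 0).
- exact: raddf0.
- by move=> a u w; rewrite linearP => -> ->; rewrite scaler0 addr0.
have [P [KsP nPK Pmin]] : exists P, covers K P.
  have [||l] := @ex_covering _ _ K submodT fV.
  - by move=> u _; apply: submodTP.
  - by move=> /(_ v (submodTP v)) /KP fv; rewrite fv eqxx in fv0.
  by case: l => [|P l] /= [KP' _]; [exists submodT | exists P].
have [||Q QP] := @submod_of_prop R W (fun w => exists2 u, u \in P & f u = w).
- by exists 0; rewrite ?rpred0 ?raddf0.
- move=> a _ _ [u uP <-] [w wP <-]; exists (a *: u + w); last exact: linearP.
  by rewrite rpredD ?rpredZ.
have cQ : covers submod0 Q.
  split.
  - by move=> w /submod0P ->; apply: rpred0.
  - move=> Q0; apply: nPK => u uP; apply/KP/submod0P/Q0/QP; by exists u.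
  move=> C _ CQ.
  have [||D DP] := @submod_of_prop R V (fun u => u \in P /\ f u \in C).
  - by rewrite raddf0 !rpred0.
  - by move=> a u w [uP uC] [wP wC]; rewrite linearP !rpredD ?rpredZ.
  case: (Pmin D).
  - by move=> u uK; apply/DP; split; [apply: KsP | have /KP -> := uK; apply: rpred0].
  - by move=> u /DP[].
  - move=> DK; left=> w wC; have /QP[u uP uw] := CQ _ wC.
    apply/submod0P; rewrite -uw; apply/KP/DK/DP; by rewrite uw.
  by move=> PD; right=> w /QP[u /PD/DP[_ ?] <-].
exists (subquot P K); split; first exact: covers_composition_factor.
apply: (mod_iso_factor (Y := subquot Q submod0)); last first.
  exact: covers_composition_factor.
apply: (subquot_iso (f := f)).
- by move=> u uP; apply/QP; exists u.
- by move=> w /QP.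
by move=> u uP; apply/idP/idP => [/KP fu|/submod0P fu]; [apply/submod0P | apply/KP].
Qed.

(** * Modules over the group algebra of a finite group *)

(** Every S-submodule is an R-submodule, so a rank on the latter restricts to the former. *)
Lemma finite_length_res (R S : nzRingType) (phi : {rmorphism R -> S})
    (V : lmodType S) : finite_length (resmod phi V) -> finite_length V.
Proof.
case=> d dP.
have e (A : submodClosed V) :
    {B : submodClosed (resmod phi V) | forall v : V, v \in B <-> v \in A}.
  apply: (@submod_of_prop R (resmod phi V) (fun v : V => v \in A)).
    exact: rpred0.
  move=> a u v uA vA; rewrite -[_ + _]/(phi a *: (u : V) + (v : V)).
  by rewrite rpredD // rpredZ.
exists (fun A => d (sval (e A))) => A B AB.
have AB' : {subset sval (e A) <= sval (e B)}.
  by move=> v /(svalP (e A)) /AB vB; apply/(svalP (e B)).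
split; first by case: (dP _ _ AB').
by move=> /(dP _ _ AB').2 BA v /(svalP (e B)) /BA /(svalP (e A)).
Qed.

Section Span.
Context (F : fieldType) (V : lmodType F).

Fixpoint in_span (vs : seq V) (v : V) : Prop :=
  if vs is x :: vs' then exists c : F, in_span vs' (v - c *: x) else v = 0.

Lemma in_spanP vs a u v :
  in_span vs u -> in_span vs v -> in_span vs (a *: u + v).
Proof.
elim: vs u v => [|x vs IH] u v /=; first by move=> -> ->; rewrite scaler0 addr0.
move=> [c uc] [d vd]; exists (a * c + d).
have -> : a *: u + v - (a * c + d) *: x = a *: (u - c *: x) + (v - d *: x).
  by rewrite scalerBr scalerDl -scalerA opprD addrACA.
exact: IH.
Qed.

Lemma in_span_sum (I : eqType) (r : seq I) (c : I -> F) (f : I -> V) :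
  in_span [seq f i | i <- r] (\sum_(i <- r) c i *: f i).
Proof.
elim: r => [|i r IH] /=; first by rewrite big_nil.
by exists (c i); rewrite big_cons addrC addKr.
Qed.

(* Counts the steps of the flag spanned by the suffixes of vs at which the
   trace of A grows. *)
Fixpoint span_length (A : submodClosed V) (vs : seq V) : nat :=
  if vs is x :: vs' then
    (`[< exists2 a, a \in A & in_span vs' (a - x) >] + span_length A vs')%N
  else 0%N.

Lemma span_finite_length vs : (forall v, in_span vs v) -> finite_length V.
Proof.
move=> vsT; exists (span_length^~ vs) => A B AB.
have ind x ws : (`[< exists2 a, a \in A & in_span ws (a - x) >] <=
    `[< exists2 a, a \in B & in_span ws (a - x) >])%N.
  case: asboolP => // -[a aA ax]; rewrite asboolT //; by exists a; rewrite ?AB.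
have le ws : (span_length A ws <= span_length B ws)%N.
  by elim: ws => //= x ws IH; rewrite leq_add.
split=> // leBA.
suff sub ws b : (span_length B ws <= span_length A ws)%N -> b \in B ->
    in_span ws b -> b \in A by move=> b bB; apply: (sub vs).
elim: ws b {leBA} => [|x ws IH] b /=; first by move=> _ _ ->; apply: rpred0.
move=> leBA bB [c bc].
have leBA' : (span_length B ws <= span_length A ws)%N.
  rewrite -(leq_add2l (`[< exists2 a, a \in B & in_span ws (a - x) >])).
  by rewrite (leq_trans leBA) // leq_add2r ind.
have [c0|c0] := eqVneq c 0.
  by apply: IH => //; move: bc; rewrite c0 scale0r subr0.
have Bx : `[< exists2 a, a \in B & in_span ws (a - x) >].
  apply/asboolP; exists (c^-1 *: b); first exact: rpredZ.
  have -> : c^-1 *: b - x = c^-1 *: (b - c *: x) + 0.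
    by rewrite scalerBr scalerA mulVf // scale1r addr0.
  apply: in_spanP => //; elim: ws {IH leBA leBA' bc} => //= y ws IH.
  by exists 0; rewrite scale0r subr0.
(* The tail count of A is at most that of B, so equality of the totals forces the trace of A to grow
   at [x] as well. Subtracting a multiple of the resulting [a] removes the leading term of [b]
   without leaving B. *)
have /asboolP[a aA ax] : `[< exists2 a, a \in A & in_span ws (a - x) >].
  move: leBA; rewrite Bx; case: `[< _ >] => //.
  by rewrite add0n add1n ltnNge => /negP[]; apply: le.
have -> : b = c *: a + (b - c *: a) by rewrite addrC subrK.
apply: rpredD; first exact: rpredZ.
apply: IH => //; first by rewrite -scaleNr rpredD ?rpredZ // AB.
have -> : b - c *: a = - c *: (a - x) + (b - c *: x).
  by rewrite scaleNr scalerBr opprB [RHS]addrC addrA subrK.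
exact: in_spanP.
Qed.
End Span.

Section GroupAlgebraModules.
Context (k : fieldType) (K : groupType).

Lemma galg_ind (P : galg k K -> Prop) :
    P 0 -> (forall a b, P a -> P b -> P (a + b)) ->
    (forall c x, P << c *g x >>) -> forall a, P a.
Proof.
by move=> P0 PD PU a; rewrite [a]monalgE; apply: (big_ind P).
Qed.

Definition galg_const (c : k) : galg k K := << c *g 1%g >>.

Lemma galg_const_is_zmod_morphism : zmod_morphism galg_const.
Proof. by move=> c d; rewrite /galg_const monalgUB. Qed.

Lemma galg_const_is_monoid_morphism : monoid_morphism galg_const.
Proof. by split=> [//|c d]; rewrite /galg_const galgU_mul mulg1. Qed.

HB.instance Definition _ := GRing.isZmodMorphism.Build k (galg k K) galg_const
  galg_const_is_zmod_morphism.
HB.instance Definition _ := GRing.isMonoidMorphism.Build k (galg k K) galg_const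
  galg_const_is_monoid_morphism.

Lemma galgUE (c : k) (x : K) : << c *g x >> = galg_const c * gelt k x.
Proof. by rewrite galgU_mul mulr1 mul1g. Qed.

Lemma galg_constC c (a : galg k K) : galg_const c * a = a * galg_const c.
Proof.
elim/galg_ind: a => [|a b IHa IHb|d x]; first by rewrite mul0r mulr0.
  by rewrite mulrDr mulrDl IHa IHb.
by rewrite !galgU_mul mul1g mulg1 mulrC.
Qed.

Lemma geltM (x y : K) : gelt k (x * y)%g = gelt k x * gelt k y.
Proof. by rewrite galgU_mul mulr1. Qed.

Lemma galg_linear (V W : lmodType (galg k K)) (f : V -> W) :
    zmod_morphism f ->
    (forall c v, f (galg_const c *: v) = galg_const c *: f v) ->
    (forall x v, f (gelt k x *: v) = gelt k x *: f v) -> linear f.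
Proof.
move=> fB fc fx.
have f0 : f 0 = 0 by have := fB 0 0; rewrite !subrr.
have fN v : f (- v) = - f v by have := fB 0 v; rewrite !sub0r f0 sub0r.
have fD u v : f (u + v) = f u + f v by have := fB u (- v); rewrite fN !opprK.
move=> a u v; rewrite fD; congr (_ + _).
elim/galg_ind: a => [|a b IHa IHb|c x]; first by rewrite !scale0r.
  by rewrite !scalerDl fD IHa IHb.
by rewrite galgUE -!scalerA fc fx.
Qed.

Definition kmod (V : lmodType (galg k K)) : lmodType k := resmod galg_const V.

(** A nonzero vector generates V over kK, hence its finitely many translates under K span V over
    k. *)
Lemma irreducible_finite_span (ks : seq K) (V : lmodType (galg k K)) :
    (forall x, x \in ks) -> irreducible V ->
  exists vs : seq (kmod V), forall v, in_span vs v.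
Proof.
move=> ksP [[m m0] irr].
have [||U UP] := @submod_of_prop _ V (fun v => exists a : galg k K, v = a *: m).
- by exists 0; rewrite scale0r.
- by move=> a _ _ [b ->] [c ->]; exists (a * b + c); rewrite scalerA scalerDl.
have mU : m \in U by apply/UP; exists 1; rewrite scale1r.
exists [seq (gelt k x *: m : kmod V) | x <- undup ks] => v.
case: (irr U) => [U0|/(_ v)/UP[a ->]]; first by rewrite (U0 m mU) eqxx in m0.
have -> : a = \sum_(x <- undup ks) galg_const a@_x * gelt k x.
  rewrite [LHS]monalgE (perm_big [seq x <- undup ks | x \in msupp a]) /=.
    rewrite big_filter big_mkcond; apply: eq_bigr => x _; rewrite -galgUE.
    by case: ifPn => // /mcoeff_outdom ->; rewrite monalgU0.
  apply: uniq_perm; rewrite ?fset_uniq ?filter_uniq ?undup_uniq // => x.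
  by rewrite mem_filter mem_undup ksP andbT.
rewrite scaler_suml; under eq_bigr do rewrite -scalerA.
exact: (@in_span_sum k (kmod V)).
Qed.
End GroupAlgebraModules.

Lemma galg_map_const (k : fieldType) (K L : groupType)
    (f : {multiplicative K -> L}) c :
  galg_map k f (galg_const K c) = galg_const L c.
Proof.
rewrite galg_mapU; congr mkmalgU; apply: (@mulgI _ (f 1%g)).
by rewrite -gmulfM !mulg1.
Qed.

Lemma resgrp_finite_length (k : fieldType) (K L : groupType)
    (f : {multiplicative K -> L}) (V : lmodType (galg k L)) (ls : seq L) :
    (forall x, x \in ls) -> irreducible V -> finite_length (resgrp f V).
Proof.
move=> lsP /(irreducible_finite_span lsP)[vs vsP].
apply: (@finite_length_res _ _ (galg_const K)).
apply: (@span_finite_length _ (kmod (resgrp f V)) vs) => v.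
(* The k-structures obtained through K and through L agree by [galg_map_const] but not by
   conversion, so membership in the span is transported one vector at a time. *)
have {vsP} := vsP v; elim: vs v => //= x vs IH v [c vc]; exists c.
suff -> : c *: (x : kmod (resgrp f V)) = c *: (x : kmod V) by apply: IH.
by rewrite -[LHS]/(galg_map k f (galg_const K c) *: (x : V)) galg_map_const.
Qed.

(** No dimension is assumed finite, so a complement is found by Zorn's lemma as a maximal subspace
    meeting U trivially. *)
Lemma subspace_complement (F : fieldType) (V : lmodType F) (U : submodClosed V) :
  exists C : submodClosed V, (forall v, v \in U -> v \in C -> v = 0) /\
    forall v, exists2 u, u \in U & v - u \in C.
Proof.
pose T := {C : V -> Prop | [/\ C 0,
  forall a u v, C u -> C v -> C (a *: u + v) &
  forall v, v \in U -> C v -> v = 0]}.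
pose r (C D : T) := `[< forall v, sval C v -> sval D v >].
have [||||C maxC] := @Zorn T r.
- by move=> C; apply/asboolP.
- by move=> C D E /asboolP CD /asboolP DE; apply/asboolP => v /CD/DE.
- move=> [C CP] [D DP] /asboolP /= CD /asboolP /= DC.
  suff e : C = D by case: _ / e DP CD DC => DP _ _; congr exist; apply: Prop_irrelevance.
  by apply: funext => v; apply: propext; split; [apply: CD | apply: DC].
(* The disjunct [v = 0] keeps the union a subspace when the chain is empty. *)
- move=> A Atot; pose D v := v = 0 \/ exists2 t, A t & sval t v.
  have DP : [/\ D 0, forall a u v, D u -> D v -> D (a *: u + v) &
      forall v, v \in U -> D v -> v = 0].
    split; first by left.
    - move=> a u v [->|[s As su]]; first by rewrite scaler0 add0r.
      move=> [->|[t At tv]].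
        by right; exists s => //; have [s0 sD _] := svalP s; apply: sD.
      right; have [/asboolP st|/asboolP ts] := Atot _ _ As At.
        by exists t => //; have [_ tD _] := svalP t; apply: tD => //; apply: st.
      by exists s => //; have [_ sD _] := svalP s; apply: sD => //; apply: ts.
    - move=> v vU [//|[t _ tv]]; by have [_ _ td] := svalP t; apply: td.
  by exists (exist _ D DP) => s As; apply/asboolP => v sv; right; exists s.
have [C0 CD Cd] := svalP C.
have [C' C'P] := submod_of_prop C0 CD.
exists C'; split=> [v vU /C'P|]; first exact: Cd.
apply: contrapT => nex; have [v vP] : exists v, forall u, u \in U -> ~ sval C (v - u).
  apply: contrapT => nex'; apply: nex => v; apply: contrapT => nv; apply: nex'.
  by exists v => u uU uC; apply: nv; exists u => //; apply/C'P.
(* If some v lies outside U + C, then C + kv still meets U trivially: a vector c + a v of U with [a]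
   nonzero would put v in U + C. Maximality then gives v in C, contradicting the choice of v. *)
pose D w := exists a, sval C (w - a *: v).
have DP : [/\ D 0, forall a u v, D u -> D v -> D (a *: u + v) &
    forall v, v \in U -> D v -> v = 0].
  split; first by exists 0; rewrite scale0r subr0.
  - move=> a w w' [b bC] [c cC]; exists (a * b + c).
    have -> : a *: w + w' - (a * b + c) *: v =
        a *: (w - b *: v) + (w' - c *: v).
      by rewrite scalerBr scalerDl -scalerA opprD addrACA.
    exact: CD.
  - move=> w wU [a aC]; have [a0|a0] := eqVneq a 0.
      by apply: Cd => //; move: aC; rewrite a0 scale0r subr0.
    case: (vP (a^-1 *: w)); first exact: rpredZ.
    have -> : v - a^-1 *: w = - a^-1 *: (w - a *: v) + 0.
      by rewrite addr0 scaleNr scalerBr opprB scalerA mulVf // scale1r.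
    exact: CD.
have eD : exist _ D DP = C.
  by apply: maxC; apply/asboolP => w wC; exists 0; rewrite scale0r subr0.
case: (vP 0); first exact: rpred0.
by rewrite subr0 -eD /=; exists 1; rewrite scale1r subrr.
Qed.

Lemma subspace_projector (F : fieldType) (V : lmodType F) (U : submodClosed V) :
  exists p : {linear V -> V}, (forall v, p v \in U) /\
    forall u, u \in U -> p u = u.
Proof.
have [C [Cd Cc]] := subspace_complement U.
have /choice[p pP] v : exists u, u \in U /\ v - u \in C.
  by have [u ? ?] := Cc v; exists u.
have pE v u : u \in U -> v - u \in C -> p v = u.
  move=> uU vuC; have [pU pC] := pP v; apply/eqP; rewrite -subr_eq0; apply/eqP.
  apply: Cd; first by rewrite addrC -scaleN1r rpredD ?rpredZ.
  have -> : p v - u = -1 *: (v - p v) + (v - u).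
    by rewrite scaleN1r opprB addrA subrK.
  by rewrite rpredD ?rpredZ.
have plin : linear p.
  move=> a u v; have [pu uC] := pP u; have [pv vC] := pP v.
  apply: pE; first by rewrite rpredD ?rpredZ.
  by rewrite opprD addrACA -scalerBr rpredD ?rpredZ.
pose pM := GRing.isLinear.Build F V V *:%R p plin.
pose pL : {linear V -> V} := HB.pack p pM.
exists pL; split=> [v|u uU] /=; first by case: (pP v).
by apply: pE => //; rewrite subrr rpred0.
Qed.

Lemma pchar0_natr_neq0 (k : fieldType) (n : nat) :
  [pchar k] =i pred0 -> (0 < n)%N -> n%:R != 0 :> k.
Proof. by move=> /pcharf0P ->; rewrite lt0n. Qed.

Lemma perm_mulg (K : groupType) (ks : seq K) (x : K) (P : {pred K}) :
    uniq ks -> (forall y, (y \in ks) = (y \in P)) ->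
    (forall y, ((x * y)%g \in P) = (y \in P)) ->
  perm_eq [seq (x * y)%g | y <- ks] ks.
Proof.
move=> uks ksP xP; apply: uniq_perm => //; first by rewrite map_inj_uniq //; apply: mulgI.
move=> y; apply/mapP/idP => [[z zk ->]|yk]; first by rewrite ksP xP -ksP.
by exists (x^-1 * y)%g; rewrite ?mulVKg // ksP -xP mulVKg -ksP.
Qed.

(** A k-linear projector [q] onto U is averaged over its conjugates by K. Characteristic 0 makes the
    order of K invertible, and left translation permutes the summands. *)
Lemma Maschke (k : fieldType) (K : groupType) (ks : seq K)
    (V : lmodType (galg k K)) (U : submodClosed V) :
    [pchar k] =i pred0 -> uniq ks -> (forall x, x \in ks) ->
  exists p : {linear V -> V}, (forall v, p v \in U) /\
    forall u, u \in U -> p u = u.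
Proof.
move=> hk uks ksP.
have [||U' U'P] := @submod_of_prop k (kmod V) (fun v : V => v \in U).
- exact: rpred0.
- move=> a u v uU vU; rewrite -[_ + _]/(galg_const K a *: (u : V) + (v : V)).
  by rewrite rpredD // rpredZ.
have [q [qU qid]] := subspace_projector U'.
have qD (u v : V) : q (u - v) = q u - q v :> V by apply: (linearB q).
have qc c (v : V) : q (galg_const K c *: v) = galg_const K c *: (q v : V).
  exact: (linearZ_LR q c v).
have n0 : (size ks)%:R != 0 :> k.
  by apply: pchar0_natr_neq0 => //; case: (ks) (ksP 1%g).
pose p (v : V) : V := galg_const K (size ks)%:R^-1 *:
  \sum_(x <- ks) gelt k x *: (q (gelt k x^-1%g *: v) : V).
have pU v : p v \in U.
  by rewrite rpredZ // rpred_sum // => x _; rewrite rpredZ //; apply/U'P/qU.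
have plin : linear p.
  apply: galg_linear.
  - move=> u v; rewrite /p -scalerBr -sumrB; congr (_ *: _); apply: eq_bigr => x _.
    by rewrite scalerBr qD scalerBr.
  - move=> c v; rewrite /p scalerA galg_constC -scalerA; congr (_ *: _).
    rewrite scaler_sumr; apply: eq_bigr => x _.
    by rewrite scalerA -galg_constC -scalerA qc !scalerA galg_constC.
  - move=> y v; rewrite /p scalerA -galg_constC -scalerA; congr (_ *: _).
    rewrite scaler_sumr -(perm_big _ (perm_mulg (x := y) (P := predT) uks _ _)) //=.
    rewrite big_map; apply: eq_bigr => x _.
    by rewrite scalerA -geltM scalerA -geltM invgM mulgVK.
pose pM := GRing.isLinear.Build (galg k K) V V *:%R p plin.
pose pL : {linear V -> V} := HB.pack p pM.
exists pL; split=> // u uU; rewrite /= /p.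
under eq_bigr => x _.
  rewrite qid; last by apply/U'P; rewrite rpredZ.
  rewrite scalerA -geltM mulgV scale1r.
  over.
rewrite big_const_seq count_predT iter_addr_0 -scaler_nat scalerA.
by rewrite -(rmorph_nat (galg_const K)) -rmorphM mulVf // rmorph1 scale1r.
Qed.

(** * Coordinates of an induced module along the cosets of H *)

Section Restriction.
Context (k : fieldType) (K L : groupType) (f : {multiplicative K -> L}).

Lemma resgrp_const (V : lmodType (galg k L)) c (v : V) :
  galg_const K c *: (v : resgrp f V) = galg_const L c *: v.
Proof. by rewrite -[LHS]/(galg_map k f _ *: v) galg_map_const. Qed.

Lemma resgrp_gelt (V : lmodType (galg k L)) x (v : V) :
  gelt k x *: (v : resgrp f V) = gelt k (f x) *: v.
Proof. by rewrite -[LHS]/(galg_map k f _ *: v) galg_mapU. Qed.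

Lemma submod_of_gprop (V : lmodType (galg k K)) (P : V -> Prop) :
    P 0 -> (forall u v, P u -> P v -> P (u + v)) ->
    (forall c v, P v -> P (galg_const K c *: v)) ->
    (forall x v, P v -> P (gelt k x *: v)) ->
  {U : submodClosed V | forall v, v \in U <-> P v}.
Proof.
move=> P0 PD Pc Px; apply: submod_of_prop => // a u v Pu Pv; apply: (PD) => //.
elim/galg_ind: a => [|a b IHa IHb|c x]; first by rewrite scale0r.
  by rewrite scalerDl; apply: PD.
by rewrite galgUE -scalerA; apply/Pc/Px.
Qed.
End Restriction.

Section Coordinates.
Context (k : fieldType) (G : groupType) (H : groupClosed G).
Implicit Types (s x : G) (h : subgrp H) (a : galg k G) (r : galg k (subgrp H)).

Lemma coset_ex s x : (s^-1 * x)%g \in H -> exists h, x = (s * \val h)%g.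
Proof. by move=> sx; exists (exist (fun y => y \in H) _ sx); rewrite /= mulVKg. Qed.

Definition coset_term s (c : k) x : galg k (subgrp H) :=
  if insub (s^-1 * x)%g is Some h then << c *g h >> else 0.

Lemma coset_term_in s c h : coset_term s c (s * \val h)%g = << c *g h >>.
Proof.
rewrite /coset_term mulKg; case: insubP => [u _ /val_inj -> //|].
by rewrite (valP h).
Qed.

Lemma coset_term_out s c x : (s^-1 * x)%g \notin H -> coset_term s c x = 0.
Proof. by move=> sx; rewrite /coset_term insubN. Qed.

Lemma coset_termB s x : zmod_morphism (coset_term s ^~ x).
Proof.
move=> c d; rewrite /coset_term; case: insub => [h|]; first exact: monalgUB.
by rewrite subr0.
Qed.

Lemma coset_term0 s x : coset_term s 0 x = 0.
Proof. by have := coset_termB s x 0 0; rewrite !subrr. Qed.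

(* The component of kG = \bigoplus_s s kH at the coset s H. *)
Definition coset_proj s a : galg k (subgrp H) :=
  \sum_(x <- msupp a) coset_term s a@_x x.

Lemma coset_projEw s (d : {fset G}) a : (msupp a `<=` d)%fset ->
  coset_proj s a = \sum_(x <- d) coset_term s a@_x x.
Proof.
move=> le; rewrite /coset_proj (big_fset_incl _ le) //= => x _ /mcoeff_outdom ->.
exact: coset_term0.
Qed.

Lemma coset_projU s c x : coset_proj s << c *g x >> = coset_term s c x.
Proof. by rewrite (coset_projEw _ msuppU_le) big_seq_fset1 mcoeffUU. Qed.

Lemma coset_projB s : zmod_morphism (coset_proj s).
Proof.
move=> a b; pose d := (msupp a `|` msupp b)%fset.
rewrite (coset_projEw s (msuppB_le a b)) (coset_projEw s (fsubsetUl _ (msupp b))).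
rewrite (coset_projEw s (fsubsetUr (msupp a) _)) -sumrB.
by apply: eq_bigr => x _; rewrite mcoeffB -coset_termB.
Qed.

HB.instance Definition _ s := GRing.isZmodMorphism.Build (galg k G)
  (galg k (subgrp H)) (coset_proj s) (coset_projB s).

Lemma coset_projMr s a r :
  coset_proj s (a * galg_map k (subgrp_incl H) r) = coset_proj s a * r.
Proof.
elim/galg_ind: a => [|a b IHa IHb|c x]; first by rewrite !(mul0r, raddf0).
  by rewrite mulrDl !raddfD /= IHa IHb mulrDl.
elim/galg_ind: r => [|a b IHa IHb|d h]; first by rewrite raddf0 !mulr0 raddf0.
  by rewrite raddfD /= !mulrDr raddfD /= IHa IHb.
rewrite galg_mapU galgU_mul !coset_projU.
have [/coset_ex[h' ->]|sx] := boolP ((s^-1 * x)%g \in H).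
  by rewrite coset_term_in galgU_mul -mulgA (coset_term_in _ _ (h' * h)%g).
by rewrite !coset_term_out ?mul0r // mulgA gpredMr //; apply: (valP h).
Qed.

Lemma coset_projMl s x a :
  coset_proj s (gelt k x * a) = coset_proj (x^-1 * s)%g a.
Proof.
elim/galg_ind: a => [|a b IHa IHb|c y]; first by rewrite mulr0 !raddf0.
  by rewrite mulrDr !raddfD /= IHa IHb.
by rewrite galgU_mul mul1r !coset_projU /coset_term invgM invgK mulgA.
Qed.

Lemma coset_proj_const s c a :
  coset_proj s (galg_const G c * a) = galg_const _ c * coset_proj s a.
Proof.
elim/galg_ind: a => [|a b IHa IHb|d y]; first by rewrite !(mulr0, raddf0).
  by rewrite mulrDr !raddfD /= IHa IHb mulrDr.
rewrite galgU_mul mul1g !coset_projU /coset_term.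
by case: insub => [h|]; rewrite ?mulr0 // galgU_mul mul1g.
Qed.

Lemma coset_proj_coset s h a :
  coset_proj (s * \val h)%g a = gelt k h^-1%g * coset_proj s a.
Proof.
elim/galg_ind: a => [|a b IHa IHb|d y]; first by rewrite !(mulr0, raddf0).
  by rewrite !raddfD /= IHa IHb mulrDr.
rewrite !coset_projU.
have [/coset_ex[h' ->]|sy] := boolP ((s^-1 * y)%g \in H); last first.
  rewrite !coset_term_out ?mulr0 //.
  by rewrite invgM -mulgA gpredMl // gpredV; apply: (valP h).
have {1}-> : (s * \val h' = s * \val h * \val (h^-1 * h')%g)%g.
  by rewrite -mulgA /= mulVKg.
by rewrite !coset_term_in galgU_mul mul1r.
Qed.

Context (M : lmodType (galg k (subgrp H))).

(** [coset_proj s] is right kH-linear, so the formula is balanced and factors through the tensor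
    product. This gives the coset components without choosing representatives. *)
Lemma ex_ind_coord s : exists c : {additive Ind H M -> M},
  forall a m, c (tensor _ a m) = coset_proj s a *: m.
Proof.
apply: (@extmod_universal _ _ (galg_map k (subgrp_incl H)) M M
  (fun a m => coset_proj s a *: m)).
- by move=> a b m; rewrite raddfD scalerDl.
- by move=> a m n; rewrite scalerDr.
- by move=> a r m; rewrite coset_projMr scalerA.
Qed.

Definition ind_coord s : {additive Ind H M -> M} := sval (cid (ex_ind_coord s)).

Definition ind_incl (m : M) : Ind H M := tensor _ 1 m.

Lemma tensorE a m : tensor _ a m = a *: ind_incl m.
Proof. by rewrite scale_tensor mulr1. Qed.

Lemma ind_coord_scale s a m : ind_coord s (a *: ind_incl m) = coset_proj s a *: m.
Proof. by rewrite -tensorE /ind_coord; case: cid. Qed.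

Lemma ind_coord_gelt s x w : ind_coord s (gelt k x *: w) = ind_coord (x^-1 * s)%g w.
Proof.
apply: (ext_eq (u := fun w => ind_coord s (gelt k x *: w))) => {w} [u v|u v|a m].
- by rewrite scalerBr raddfB.
- exact: raddfB.
- by rewrite tensorE (scalerA _ a (ind_incl m)) !ind_coord_scale coset_projMl.
Qed.

Lemma ind_coord_const s c w :
  ind_coord s (galg_const G c *: w) = galg_const _ c *: ind_coord s w.
Proof.
apply: (ext_eq (u := fun w => ind_coord s (galg_const G c *: w))
  (v := fun w => galg_const _ c *: ind_coord s w)) => {w} [u v|u v|a m].
- by rewrite scalerBr raddfB.
- by rewrite raddfB scalerBr.
- rewrite tensorE (scalerA _ a (ind_incl m)).
  rewrite [LHS]ind_coord_scale [X in _ = _ *: X]ind_coord_scale coset_proj_const.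
  exact/esym/scalerA.
Qed.

(** The coordinate depends on the representative of the coset through the action of H; this
    dependence is the source of the twist by s. *)
Lemma ind_coord_coset s h w :
  ind_coord (s * \val h)%g w = gelt k h^-1%g *: ind_coord s w.
Proof.
apply: (ext_eq (u := ind_coord (s * \val h)%g)
  (v := fun w => gelt k h^-1%g *: ind_coord s w)) => {w} [u v|u v|a m].
- exact: raddfB.
- by rewrite raddfB scalerBr.
- rewrite tensorE [LHS]ind_coord_scale [X in _ = _ *: X]ind_coord_scale.
  rewrite coset_proj_coset; exact/esym/scalerA.
Qed.

Lemma ind_inclB : zmod_morphism ind_incl.
Proof.
move=> m n; apply/eqP; rewrite eq_sym subr_eq; apply/eqP.
by rewrite /ind_incl -tensorDr subrK.
Qed.

HB.instance Definition _ :=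
  GRing.isZmodMorphism.Build M (Ind H M) ind_incl ind_inclB.

Lemma ind_inclZ r m :
  ind_incl (r *: m) = galg_map k (subgrp_incl H) r *: ind_incl m.
Proof. by rewrite -tensorE /ind_incl -tensor_balanced mul1r. Qed.

Lemma ind_incl_gelt h m : ind_incl (gelt k h *: m) = gelt k (\val h) *: ind_incl m.
Proof. by rewrite ind_inclZ galg_mapU. Qed.

Lemma ind_incl_const c m :
  ind_incl (galg_const _ c *: m) = galg_const G c *: ind_incl m.
Proof. by rewrite ind_inclZ galg_map_const. Qed.

Lemma ind_coord1_incl m : ind_coord 1%g (ind_incl m) = m.
Proof.
rewrite -[ind_incl m]scale1r ind_coord_scale galg1E coset_projU.
have {2}-> : 1%g = (1 * \val (1 : subgrp H))%g :> G by rewrite mul1g.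
by rewrite coset_term_in scale1r.
Qed.

Lemma ind_sum (w : Ind H M) : exists l : seq (G * M),
  w = \sum_(p <- l) gelt k p.1 *: ind_incl p.2.
Proof.
elim/ext_ind: w => [|u v [l1 ->] [l2 ->]|u [l ->]|a m].
- by exists [::]; rewrite big_nil.
- by exists (l1 ++ l2); rewrite big_cat.
- exists [seq (p.1, - p.2) | p <- l]; rewrite big_map -sumrN.
  by apply: eq_bigr => p _; rewrite raddfN scalerN.
exists [seq (x, galg_const _ a@_x *: m) | x <- msupp a].
rewrite big_map tensorE {1}[a]monalgE scaler_suml; apply: eq_bigr => x _ /=.
by rewrite ind_incl_const scalerA -galg_constC -galgUE.
Qed.
End Coordinates.

(** * One level of the quasi-finite sequence *)

Section Level.
Context (k : fieldType) (hk : [pchar k] =i pred0).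
Context (G : groupType) (H A : groupClosed G).
Context (gs : seq G) (ugs : uniq gs) (gsP : forall x, (x \in gs) = (x \in A)).
Context (M : lmodType (galg k (subgrp H))).
Context (N : submodClosed (resgrp (subgrp_incl (capH H A)) M)).

Lemma level_gelt h (m : M) : \val h \in A -> m \in N -> gelt k h *: m \in N.
Proof.
move=> hA mN; pose h' : subgrp (capH H A) := exist (fun y => y \in capH H A) h hA.
by rewrite -[h]/(subgrp_incl (capH H A) h') -resgrp_gelt; apply: rpredZ.
Qed.

Lemma level_const c (m : M) : m \in N -> galg_const _ c *: m \in N.
Proof.
by move=> mN; rewrite -(resgrp_const (subgrp_incl (capH H A))); apply: rpredZ.
Qed.

Lemma val_level_gelt (h : subgrp (capH H A)) (v : submod N) :
  \val (gelt k h *: v) = gelt k (\val h) *: (\val v : M) :> M.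
Proof. by rewrite -[RHS](resgrp_gelt (subgrp_incl (capH H A))). Qed.

Lemma val_levelB (v w : submod N) : \val (v - w) = \val v - \val w :> M.
Proof. by []. Qed.

Lemma val_levelD (v w : submod N) : \val (v + w) = \val v + \val w :> M.
Proof. by []. Qed.

Lemma val_level_const c (v : submod N) :
  \val (galg_const _ c *: v) = galg_const _ c *: (\val v : M) :> M.
Proof. by rewrite -[RHS](resgrp_const (subgrp_incl (capH H A))). Qed.

Lemma ind_coord_gen s x (m : M) :
  ind_coord M s (gelt k x *: ind_incl m) = coset_term H s 1 x *: m.
Proof. by rewrite ind_coord_scale coset_projU. Qed.

Lemma gelt_ind_coord s x (m : M) :
  gelt k s *: ind_incl (ind_coord M s (gelt k x *: ind_incl m)) =
  (gelt k x *: ind_incl m) *+ ((s^-1 * x)%g \in H).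
Proof.
rewrite ind_coord_gen; have [/coset_ex[h ->]|sx] := boolP (_ \in H); last first.
  by rewrite coset_term_out // scale0r raddf0 scaler0.
by rewrite coset_term_in ind_incl_gelt mulr1n geltM -[RHS]scalerA.
Qed.

(* Describes kA N inside Ind_H^G M.  Summing over A rather than over coset
   representatives counts each coset |H :&: A| times. *)
Definition in_level (w : Ind H M) :=
  (forall g, g \in A -> ind_coord M g w \in N) /\
  \sum_(g <- gs) gelt k g *: ind_incl (ind_coord M g w) = w *+ count [in H] gs.

Lemma perm_level x : x \in A -> perm_eq [seq (x * y)%g | y <- gs] gs.
Proof. by move=> xA; apply: perm_mulg gsP _ => // y; rewrite gpredMl. Qed.

(** If x = g h with g in A, then h lies in both H and A and so preserves N. In the sum only the g in
    xH survive, and translation by x matches them with the elements of A in H. *)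
Lemma in_level_gen x (m : M) :
  x \in A -> m \in N -> in_level (gelt k x *: ind_incl m).
Proof.
move=> xA mN; split=> [g gA|].
  rewrite ind_coord_gen.
  have [/[dup] gx /coset_ex[h xE]|gx] := boolP ((g^-1 * x)%g \in H).
    rewrite xE coset_term_in; apply: level_gelt => //.
    by move: xA; rewrite xE gpredMl.
  by rewrite coset_term_out // scale0r; apply: rpred0.
under eq_bigr do rewrite gelt_ind_coord.
rewrite -(perm_big _ (perm_level xA)) /= big_map.
rewrite sumrMnr; congr (_ *+ _); rewrite -sum1_count [RHS]big_mkcond /=.
apply: eq_bigr => g _; rewrite invgM mulgVK gpredV.
by case: (g \in H).
Qed.

Lemma in_level0 : in_level 0.
Proof.
split=> [g _|]; first by rewrite raddf0; apply: rpred0.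
by rewrite mul0rn big1 // => g _; rewrite !raddf0.
Qed.

Lemma in_levelD u v : in_level u -> in_level v -> in_level (u + v).
Proof.
move=> [uN uE] [vN vE]; split=> [g gA|].
  by rewrite raddfD; apply: rpredD; [apply: uN | apply: vN].
rewrite mulrnDl -uE -vE -big_split; apply: eq_bigr => g _ /=.
by rewrite !raddfD.
Qed.

Lemma in_level_scale_const c w :
  in_level w -> in_level (galg_const G c *: w).
Proof.
move=> [wN wE]; split=> [g gA|].
  by rewrite ind_coord_const; apply/level_const/wN.
rewrite scalerMnr -wE scaler_sumr; apply: eq_bigr => g _.
by rewrite ind_coord_const ind_incl_const !scalerA galg_constC.
Qed.

Lemma in_level_scale_gelt x w : x \in A ->
  in_level w -> in_level (gelt k x *: w).
Proof.
move=> xA [wN wE]; split=> [g gA|].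
  by rewrite ind_coord_gelt; apply: wN; rewrite gpredMl // gpredV.
rewrite scalerMnr -wE scaler_sumr -[LHS](perm_big _ (perm_level xA)) big_map.
by apply: eq_bigr => g _; rewrite ind_coord_gelt mulKg geltM -[LHS]scalerA.
Qed.

Lemma card_neq0 : (count [in H] gs)%:R != 0 :> k.
Proof.
apply: pchar0_natr_neq0 => //; rewrite -has_count; apply/hasP; exists 1%g.
  by rewrite gsP; apply: gpred1.
exact: gpred1.
Qed.

Lemma mulrn_card_inj (u v : Ind H M) :
  u *+ count [in H] gs = v *+ count [in H] gs -> u = v.
Proof.
have cK (w : Ind H M) :
    galg_const G (count [in H] gs)%:R^-1 *: (w *+ count [in H] gs) = w.
  rewrite -scaler_nat scalerA -(rmorph_nat (galg_const G)) -rmorphM mulVf.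
    by rewrite rmorph1 scale1r.
  exact: card_neq0.
by move=> e; rewrite -[u]cK e cK.
Qed.

Lemma ex_level (U : submodClosed (Ind H M)) :
  {W : submodClosed (resgrp (subgrp_incl A) (Ind H M)) |
    forall w : Ind H M, w \in W <-> w \in U /\ in_level w}.
Proof.
apply: (@submod_of_gprop _ _ (resgrp (subgrp_incl A) (Ind H M))
  (fun w : Ind H M => w \in U /\ in_level w)).
- by split; [apply: rpred0 | apply: in_level0].
- by move=> u v [uU uL] [vU vL]; split; [apply: rpredD | apply: in_levelD].
- move=> c v [vU vL]; rewrite resgrp_const.
  by split; [apply: rpredZ | apply: in_level_scale_const].
- move=> x v [vU vL]; rewrite resgrp_gelt.
  by split; [apply: rpredZ | apply: in_level_scale_gelt => //; apply: (valP x)].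
Qed.


(** The finite Mackey argument: the projector p onto the level part of U fixes u, so it cannot
    vanish on 1 (x) N, and what it yields there lies both in U and in 1 (x) N. *)
Lemma level_incl_in_submod (U : submodClosed (Ind H M)) (u : Ind H M) :
    irreducible (submod N) ->
    (forall s (sA : s \in A), s \notin H -> ~ common_composition_factor
       (resgrp (conj_twist H A sA) (submod N))
       (resgrp (conj_incl H A s) (submod N))) ->
    u \in U -> in_level u -> u != 0 ->
  exists2 m : M, m != 0 & ind_incl m \in U.
Proof.
move=> irrN hcomp uU uL u0; have [W WP] := ex_level U.
pose As : seq (subgrp A) := pmap insub gs.
have AsP x : x \in As by rewrite mem_pmap_sub gsP (valP x).
have uAs : uniq As by rewrite pmap_sub_uniq.
have [p [pW pid]] := Maschke W hk uAs AsP.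
have pB (v w : Ind H M) : p (v - w) = p v - p w :> Ind H M by apply: (linearB p).
have pc c (w : Ind H M) : p (galg_const G c *: w) = galg_const G c *: (p w : Ind H M).
  rewrite -[in LHS](resgrp_const (subgrp_incl A)) -[RHS](resgrp_const (subgrp_incl A)).
  exact: linearZ_LR.
have px x (w : Ind H M) : x \in A -> p (gelt k x *: w) = gelt k x *: (p w : Ind H M).
  move=> xA; pose x' : subgrp A := exist (fun y => y \in A) x xA.
  rewrite -[x]/(subgrp_incl A x') -[in LHS]resgrp_gelt -[RHS]resgrp_gelt.
  exact: linearZ_LR.
have pU (w : Ind H M) : (p w : Ind H M) \in U by have /WP[] := pW w.
have pL (w : Ind H M) : in_level (p w) by have /WP[] := pW w.
pose Ls : seq (subgrp (capH H A)) := pmap insub (pmap insub gs : seq (subgrp H)).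
have LsP x : x \in Ls by rewrite mem_pmap_sub mem_pmap_sub gsP; apply: (valP x).
have vanish s (m : M) : s \in A -> s \notin H -> m \in N ->
    ind_coord M s (p (ind_incl m)) = 0.
  move=> sA sH mN; apply: contrapT => /eqP nz; apply: (hcomp s sA sH).
  pose F (v : resgrp (conj_incl H A s) (submod N)) :
      resgrp (conj_twist H A sA) (submod N) :=
    exist (fun v => v \in N) (ind_coord M s (p (ind_incl (\val v : M))))
      ((pL _).1 s sA).
  have Fc c (v : submod N) :
      ind_coord M s (p (ind_incl (\val (galg_const _ c *: v) : M))) =
      galg_const _ c *: ind_coord M s (p (ind_incl (\val v : M))).
    by rewrite val_level_const ind_incl_const pc ind_coord_const.
  have Fg (g : subgrp (conj_cap H A s)) (v : submod N) :
      ind_coord M s (p (ind_incl (\val (gelt k (conj_incl H A s g) *: v) : M))) =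
      gelt k (\val (conj_twist H A sA g)) *: ind_coord M s (p (ind_incl (\val v : M))).
    rewrite val_level_gelt ind_incl_gelt px; last exact: conj_capA.
    rewrite ind_coord_gelt.
    (* [g] fixes the coset sH; returning from the representative g^-1 s to s costs exactly the
       action of s^-1 g s, which is the twisted action. *)
    have -> : ((\val g)^-1 * s = s * \val (\val (conj_twist H A sA g))^-1)%g.
      by rewrite /= /conjg !invgM invgK !mulgA mulgV mul1g.
    by rewrite ind_coord_coset invgK.
  have Flin : linear F.
    apply: galg_linear => [v w|c v|g v]; apply: val_inj.
    - by rewrite [RHS]val_levelB /= [X in ind_incl X]val_levelB raddfB pB raddfB.
    - apply: etrans (congr1 (fun w : submod N => \val (F w))
        (@resgrp_const _ _ _ (conj_incl H A s) (submod N) c v)) _.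
      apply: etrans (Fc c v) _; apply: esym.
      apply: etrans (congr1 (fun w : submod N => \val w)
        (@resgrp_const _ _ _ (conj_twist H A sA) (submod N) c (F v))) _.
      exact: val_level_const.
    - apply: etrans (congr1 (fun w : submod N => \val (F w))
        (@resgrp_gelt _ _ _ (conj_incl H A s) (submod N) g v)) _.
      apply: etrans (Fg g v) _; apply: esym.
      apply: etrans (congr1 (fun w : submod N => \val w)
        (@resgrp_gelt _ _ _ (conj_twist H A sA) (submod N) g (F v))) _.
      exact: val_level_gelt.
  have [X [X1 X2]] := @hom_common_factor _ _ _ F
    (exist (fun v => v \in N) m mN) Flin
    (resgrp_finite_length _ LsP irrN) (resgrp_finite_length _ LsP irrN) nz.
  exact (ex_intro _ X (conj X2 X1)).
(* In the expansion over A, elements outside H contribute nothing by [vanish], while each g in H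
   contributes the same term, since the g^-1 acting on the coordinate cancels the factor g. *)
have pE (m : M) : m \in N ->
    p (ind_incl m) = ind_incl (ind_coord M 1%g (p (ind_incl m))).
  move=> mN; apply: mulrn_card_inj; rewrite -(pL _).2.
  rewrite -sum1_count [X in _ *+ X]big_mkcond -sumrMnr; apply: eq_big_seq => g.
  rewrite gsP => gA; case: ifPn => gH; last by rewrite vanish // !raddf0.
  pose h : subgrp H := exist (fun y => y \in H) g gH.
  have {2}-> : g = (1 * \val h)%g by rewrite mul1g.
  rewrite ind_coord_coset ind_incl_gelt [LHS]scalerA -geltM.
  by rewrite -[g]/(\val h) /= mulgV scale1r.
have [||||Q QP] := @submod_of_gprop _ _ (submod N)
    (fun m => ind_incl (\val m : M) \in U).
- by rewrite raddf0 rpred0.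
- move=> v w vQ wQ; rewrite [X in ind_incl X]val_levelD raddfD.
  by apply: rpredD; [exact: vQ | exact: wQ].
- move=> c v vQ; rewrite [X in ind_incl X]val_level_const ind_incl_const.
  exact: rpredZ.
- move=> h v vQ; rewrite [X in ind_incl X]val_level_gelt ind_incl_gelt.
  exact: rpredZ.
have [_ /(_ Q)[Q0|QT]] := irrN; last first.
  have [[m m0] _] := irrN; exists (\val m); last exact/QP/QT.
  by apply: contra m0 => /eqP m0; apply/eqP/val_inj.
(* The image p(1 (x) m) is 1 (x) m' and lies in U, so m' belongs to [Q], which is zero in this
   case. *)
have p0 (m : M) : m \in N -> p (ind_incl m) = 0.
  move=> mN; pose m' : submod N := exist (fun v => v \in N)
    (ind_coord M 1%g (p (ind_incl m))) ((pL _).1 1%g gpred1).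
  have /Q0 m'0 : m' \in Q by apply/QP; rewrite /= -pE.
  rewrite pE // -[ind_coord _ _ _]/(\val m') m'0; exact: raddf0.
have pMn (w : Ind H M) n : p (w *+ n) = p w *+ n :> Ind H M by apply: (raddfMn p).
have psum (F : G -> Ind H M) :
    p (\sum_(g <- gs) F g) = \sum_(g <- gs) (p (F g) : Ind H M).
  exact: (raddf_sum p).
(* Up to the invertible multiplicity, u is a sum of translates by A of elements of 1 (x) N. As p
   commutes with A, it would kill u, yet it fixes u. *)
have pu : p u = u by apply/pid/WP.
case/eqP: u0; apply: mulrn_card_inj; rewrite mul0rn -{1}pu -pMn -uL.2 psum.
rewrite big_seq big1 // => g; rewrite gsP => gA.
by rewrite px // p0 ?scaler0 //; apply: uL.1.
Qed.
End Level.

(** * From the finite levels to the whole group *)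

Lemma quasi_finite_common_index (k : fieldType) (G : groupType)
    (Gs : nat -> groupClosed G) (H : groupClosed G)
    (M : lmodType (galg k (subgrp H)))
    (Ms : forall i, submodClosed (resgrp (subgrp_incl (induced_seq H Gs i)) M))
    (l : seq (G * M)) :
    quasi_finite_seq Gs -> quasi_finite_mod_seq Ms ->
  exists r, forall x m, (x, m) \in l -> x \in Gs r /\ m \in Ms r.
Proof.
move=> [_ GsT Gsdir] [_ Msle MsT].
have le i r : {subset Gs i <= Gs r} -> {subset Ms i <= Ms r}.
  by move=> ir; apply: Msle => h; apply: ir.
elim: l => [|[x m] l [r rP]]; first by exists 0%N.
have [i xi] := GsT x; have [j mj] := MsT m.
have [n [ni nj]] := Gsdir i j; have [t [tn tr]] := Gsdir n r.
exists t => y v; rewrite inE => /orP[/eqP[-> ->]|/rP[yr vr]].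
  by split; [apply/tn/ni | apply/(le _ _ tn)/(le _ _ nj)].
by split; [apply: tr | apply: (le _ _ tr)].
Qed.

Theorem mainTheorem7 (k : fieldType) (hk : [pchar k] =i pred0)
    (G : groupType) (Gs : nat -> groupClosed G) (hGs : quasi_finite_seq Gs)
    (H : groupClosed G) (M : lmodType (galg k (subgrp H)))
    (Ms : forall i,
       submodClosed (resgrp (subgrp_incl (induced_seq H Gs i)) M))
    (hM : irreducible M)
    (hMs : quasi_finite_mod_seq Ms)
    (hcomp : forall (i : nat) (s : G) (sG : s \in Gs i), s \notin H ->
       ~ common_composition_factor
           (resgrp (conj_twist H (Gs i) sG) (submod (Ms i)))
           (resgrp (conj_incl H (Gs i) s) (submod (Ms i)))) :
  irreducible (Ind H M).
Proof.
have [[m m0] irrM] := hM; split.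
  exists (ind_incl m); apply: contra m0 => /eqP e.
  by rewrite -(ind_coord1_incl m) e raddf0.
move=> U; have [|nU] := pselect (forall v, v \in U -> v = 0); [by left | right].
have [u uU u0] : exists2 u, u \in U & u != 0.
  apply: contrapT => nex; apply: nU => v vU; apply: contrapT => /eqP v0.
  by apply: nex; exists v.
have [l ul] := ind_sum u.
have [r rP] := quasi_finite_common_index l hGs hMs.
have [Gfin _ _] := hGs; have [irrMs _ _] := hMs.
have [gs gsE] := (finite_seqP _).1 (Gfin r).
have gsP x : (x \in undup gs) = (x \in Gs r).
  rewrite mem_undup; apply/idP/idP => xr.
    have : [set` gs]%classic x by apply: xr.
    by rewrite -gsE.
  have : [set y | y \in Gs r]%classic x by apply: xr.
  by rewrite gsE.
have uL : in_level (undup gs) (Ms r) u.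
  rewrite ul big_seq; apply: (big_ind (in_level (undup gs) (Ms r))).
  - exact: in_level0.
  - by move=> v w; apply: in_levelD.
  - by move=> [x v] /rP[xr vr]; apply: (in_level_gen (undup_uniq gs) gsP).
have [n n0 nU'] := level_incl_in_submod hk (undup_uniq gs) gsP (irrMs r)
  (hcomp r) uU uL u0.
(* The vectors v of M with 1 (x) v in U form a kH-submodule containing the nonzero [n], hence all of
   M; and 1 (x) M generates the induced module over kG. *)
have [||Q QP] := @submod_of_prop _ M (fun v => ind_incl v \in U).
- by rewrite raddf0 rpred0.
- move=> a v w vU wU.
  have -> : ind_incl (a *: v + w) = ind_incl (a *: v) + ind_incl w by apply: raddfD.
  rewrite (ind_inclZ a v).
  by apply: rpredD; [apply: rpredZ; exact: vU | exact: wU].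
have [Q0|QT] := irrM Q.
  by have := Q0 n (proj2 (QP n) nU') => nz; rewrite nz eqxx in n0.
move=> w; have [lw ->] := ind_sum w; apply: rpred_sum => p _; apply: rpredZ.
exact/QP/QT.
Qed.
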